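(* Let $\mathcal E$ be a local Dirichlet form on $L_2(X)$ with $1\in D(\mathcal E)_{\rm loc}$ and such that $D(\mathcal E)\cap L_{\infty,c}(X)$ is a core for $\mathcal E$. Let $d(\cdot\,;\cdot)=d^{(\mathcal E)}(\cdot\,;\cdot)$ denote the corresponding set-theoretic distance. Let $H$ be the positive self-adjoint operator on $L_2(X)$ associated with $\mathcal E$ and $S_t=e^{-tH}$ the semigroup generated by $H$. Let $A\subset X$ be measurable and $A^{\rm c}$ its complement. Then the following conditions are equivalent. I. $S_tL_2(A)\subseteq L_2(A)$ for one $t>0$. II. $S_tL_2(A)\subseteq L_2(A)$ for all $t>0$. III. $d(A\,;A^{\rm c})=\infty$. IV. $d(A\,;A^{\rm c})>0$.
   Context: $X$ is a topological Hausdorff space equipped with a $\sigma$-finite Borel measure $\mu$; $L_p(X)=L_p(X,\mu)$ consists of complex-valued functions, $L_\infty(X\!:\!\mathbf R)$ denotes the real-valued bounded measurable functions; $1$ is the constant function one; $L_2(A)$ is the subspace of $L_2(X)$ of functions vanishing a.e. outside $A$. Write $\mathcal E(\varphi)=\mathcal E(\varphi,\varphi)$. A Dirichlet form $\mathcal E$ is local if $\mathcal E(\psi,\varphi)=0$ for all $\varphi,\psi\in D(\mathcal E)$ and $a\in\mathbf R$ such that $(\varphi+a1)\psi=0$. A core for $\mathcal E$ is a subspace dense in $D(\mathcal E)$ for the norm $\varphi\mapsto(\mathcal E(\varphi)+\|\varphi\|_2^2)^{1/2}$. $(\operatorname{supp}\varphi)^{\rm c}$ is the union of all open $U\subseteq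 X$ with $\varphi|_U=0$ a.e.; $L_{\infty,c}(X)$ (resp. $L_{\infty,c}(X\!:\!\mathbf R)$) is the set of $\varphi\in L_\infty(X)$ (resp. $L_\infty(X\!:\!\mathbf R)$) with compact support. $D(\mathcal E)_{\rm loc}$ is the vector space of (classes of) measurable $\psi\colon X\to\mathbf C$ such that for every compact $K\subseteq X$ there is a $\hat\psi\in D(\mathcal E)$ with $\psi|_K=\hat\psi|_K$. For $\psi,\varphi\in D(\mathcal E)\cap L_\infty(X\!:\!\mathbf R)$ set $\mathcal I_\psi(\varphi)=\mathcal E(\psi\varphi,\psi)-2^{-1}\mathcal E(\psi^2,\varphi)$. For $\psi\in D(\mathcal E)_{\rm loc}\cap L_\infty(X\!:\!\mathbf R)$ and $\varphi\in D(\mathcal E)\cap L_{\infty,c}(X\!:\!\mathbf R)$ set $\widehat{\mathcal I}_\psi(\varphi)=\mathcal I_{\hat\psi}(\varphi)$, where $\hat\psi\in D(\mathcal E)\cap L_\infty(X\!:\!\mathbf R)$ satisfies $\psi|_{\operatorname{supp}\varphi}=\hat\psi|_{\operatorname{supp}\varphi}$ (well defined by locality). Set $$|||\widehat{\mathcal I}_\psi|||=\sup\{|\widehat{\mathcal I}_\psi(\varphi)|:\varphi\in D(\mathcal E)\cap L_{\infty,c}(X\!:\!\mathbf R),\ \|\varphi\|_1\le1\}\in[0,\infty].$$ For $\psi\in L_\infty(X\!:\!\mathbf R)$ and measurable $A,B\subseteq X$ set $$d_\psi(A\,;B)=\operatorname{ess\,inf}_{x\in A}\psi(x)-\operatorname{ess\,sup}_{y\in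 B}\psi(y)\in(-\infty,\infty],$$ where $\operatorname{ess\,sup}_{y\in B}\psi(y)=\inf\{m\in\mathbf R:\mu(\{y\in B:\psi(y)>m\})=0\}$ and $\operatorname{ess\,inf}_{x\in A}\psi(x)=-\operatorname{ess\,sup}_{x\in A}(-\psi(x))$. Finally $$d^{(\mathcal E)}(A\,;B)=\sup\{d_\psi(A\,;B):\psi\in D_0(\mathcal E)\},\qquad D_0(\mathcal E)=\{\psi\in D(\mathcal E)_{\rm loc}\cap L_\infty(X\!:\!\mathbf R):|||\widehat{\mathcal I}_\psi|||\le1\}.$$
   Formalization: ''Compact support'' of φ is read as: supp φ is compact and φ = 0 a.e. outside supp φ; the second part is automatic for Radon measures or hereditarily Lindelöf X, and without it Î_ψ(φ) need not be well defined (e.g. Lebesgue × Dieudonné measure on [0,1]×ω₁). *)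

(* Defs.v *)
From HB Require Import structures.
From mathcomp Require Import all_boot all_order all_algebra.
From mathcomp Require Import all_classical all_reals all_analysis.
From mathcomp Require Import complex.

Set Implicit Arguments.
Unset Strict Implicit.
Unset Printing Implicit Defensive.

Import Order.TTheory GRing.Theory Num.Theory.
Import numFieldNormedType.Exports.
Import Normc.

Local Open Scope classical_set_scope.
Local Open Scope ring_scope.
Local Open Scope complex_scope.

(* Elements of L_p are handled through representatives T -> R[i]; every set of
   representatives below is closed under a.e. equality, either by construction
   or (form domains) by an explicit axiom. *)

Section complex_L2.
Context {d : measure_display} {T : measurableType d} {R : realType}.
Variable mu : {measure set T -> \bar R}.
Implicit Types (f g : T -> R[i]) (u : T -> R) (A : set T).

Definition cmeasurable f : Prop :=
  measurable_fun [set: T] (fun x => complex.Re (f x)) /\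
  measurable_fun [set: T] (fun x => complex.Im (f x)).

Definition cplx u : T -> R[i] := fun x => (u x)%:C.

Definition cconj f : T -> R[i] := fun x => (f x)^*.

Definition cLnorm (p : \bar R) f : \bar R :=
  'N[mu]_p[EFin \o (@normc R \o f)]%E.

Definition L2dist f g : \bar R := cLnorm 2%:E (f \- g).

Definition Lp (p : \bar R) : set (T -> R[i]) :=
  [set f | cmeasurable f /\ (cLnorm p f < +oo)%E].

Definition L2 : set (T -> R[i]) := Lp 2%:E.

(* linear in the first argument *)
Definition L2dot f g : R[i] :=
  (\int[mu]_x complex.Re (f x * (g x)^*)) +i* (\int[mu]_x complex.Im (f x * (g x)^*)).

Definition L2on A : set (T -> R[i]) :=
  [set f | L2 f /\ f = cst 0 %[ae mu in ~` A]].

Definition Linfty_real : set (T -> R) :=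
  [set u | measurable_fun [set: T] u /\ finite_norm mu +oo%E u].

(* ess_sup_on u B = -oo for null B, as the infimum of all reals *)
Definition ess_sup_on u A : \bar R :=
  ereal_inf [set m%:E | m in [set m : R | mu (A `&` [set x | m < u x]) = 0%E]].

Definition ess_inf_on u A : \bar R := (- ess_sup_on (fun x => (- u x)%R) A)%E.

Definition gap u A B : \bar R := (ess_inf_on u A - ess_sup_on u B)%E.

End complex_L2.

Record L2form {d : measure_display} (T : measurableType d) (R : realType) := L2Form {
  dom : set (T -> R[i]) ;
  form_val :> (T -> R[i]) -> (T -> R[i]) -> R[i] }.

Section forms.
Context {d : measure_display} {T : measurableType d} {R : realType}.
Variable mu : {measure set T -> \bar R}.
Variable E : L2form T R.
Implicit Types (f g h : T -> R[i]) (u : T -> R).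

Definition form_norm f : R :=
  Num.sqrt (complex.Re (E f f) + (fine (cLnorm mu 2%:E f)) ^+ 2).

Record ae_compatible : Prop := AeCompatible {
  dom_L2 : dom E `<=` L2 mu ;
  dom_ae : forall f g, dom E f -> cmeasurable g -> f = g %[ae mu] -> dom E g ;
  form_ae : forall f g h, dom E f -> dom E g -> dom E h ->
    f = g %[ae mu] -> E f h = E g h }.

Record positive_hermitian : Prop := PositiveHermitian {
  dom_zero : dom E (cst 0) ;
  dom_add : forall f g, dom E f -> dom E g -> dom E (f \+ g) ;
  dom_scale : forall (c : R[i]) f, dom E f -> dom E (cst c \* f) ;
  form_add : forall f g h, dom E f -> dom E g -> dom E h ->
    E (f \+ g) h = E f h + E g h ;
  form_scale : forall (c : R[i]) f h, dom E f -> dom E h ->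
    E (cst c \* f) h = c * E f h ;
  form_hermitian : forall f g, dom E f -> dom E g -> E g f = (E f g)^* ;
  form_ge0 : forall f, dom E f -> 0 <= E f f }.

Definition densely_defined : Prop :=
  forall f, L2 mu f -> forall e : R, 0 < e ->
    exists2 g, dom E g & (L2dist mu f g < e%:E)%E.

Definition closed_form : Prop :=
  forall f_ : nat -> T -> R[i], (forall n, dom E (f_ n)) ->
    (forall e : R, 0 < e -> exists N : nat, forall m n : nat,
      (N <= m)%N -> (N <= n)%N -> form_norm (f_ m \- f_ n) < e) ->
    exists2 f, dom E f & form_norm (f_ n \- f) @[n --> \oo] --> (0 : R).

(* The form is the complexification of its restriction to real functions. *)
Definition real_form : Prop :=
  forall f, dom E f -> dom E (cconj f) /\ E (cconj f) (cconj f) = E f f.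

Definition markovian : Prop :=
  forall u, dom E (cplx u) ->
    let v := fun x => Num.min (Num.max (u x) 0) 1 in
    dom E (cplx v) /\ E (cplx v) (cplx v) <= E (cplx u) (cplx u).

Record dirichlet_form : Prop := DirichletForm {
  dirichlet_ae : ae_compatible ;
  dirichlet_positive : positive_hermitian ;
  dirichlet_dense : densely_defined ;
  dirichlet_closed : closed_form ;
  dirichlet_real : real_form ;
  dirichlet_markov : markovian }.

Definition local_form : Prop :=
  forall psi phi (a : R), dom E psi -> dom E phi ->
    (fun x => (phi x + a%:C) * psi x) = cst 0 %[ae mu] -> E psi phi = 0.

Definition core (C : set (T -> R[i])) : Prop :=
  [/\ C `<=` dom E,
      [/\ C (cst 0), forall f g, C f -> C g -> C (f \+ g)
        & forall (c : R[i]) f, C f -> C (cst c \* f)]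
    & forall f, dom E f -> forall e : R, 0 < e ->
        exists2 g, C g & form_norm (f \- g) < e].

(* Graph of the positive self-adjoint operator H associated with E:
   f in D(H) and H f = g iff f in D(E) and E(f, h) = (g, h) for h in D(E). *)
Definition associated_operator : (T -> R[i]) -> (T -> R[i]) -> Prop :=
  fun f g => [/\ dom E f, L2 mu g & forall h, dom E h -> E f h = L2dot mu g h].

Definition energy u (phi : T -> R) : R[i] :=
  E (cplx (u \* phi)) (cplx u) - 2^-1 * E (cplx (u \* u)) (cplx phi).

End forms.

Section semigroups.
Context {d : measure_display} {T : measurableType d} {R : realType}.
Variable mu : {measure set T -> \bar R}.
Implicit Types (S : R -> (T -> R[i]) -> (T -> R[i])) (f g : T -> R[i]).

Record bounded_operator (B : (T -> R[i]) -> (T -> R[i])) : Prop :=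
  BoundedOperator {
  bop_L2 : forall f, L2 mu f -> L2 mu (B f) ;
  bop_ae : forall f g, L2 mu f -> L2 mu g -> f = g %[ae mu] ->
    B f = B g %[ae mu] ;
  bop_linear : forall (c : R[i]) f g, L2 mu f -> L2 mu g ->
    B ((cst c \* f) \+ g) = (cst c \* B f) \+ B g %[ae mu] ;
  bop_bounded : exists M : R, forall f, L2 mu f ->
    (cLnorm mu 2%:E (B f) <= M%:E * cLnorm mu 2%:E f)%E }.

(* Only the values of S at times t >= 0 matter. *)
Record C0_semigroup S : Prop := C0Semigroup {
  sg_bounded : forall t : R, 0 <= t -> bounded_operator (S t) ;
  sg_zero : forall f, L2 mu f -> S 0 f = f %[ae mu] ;
  sg_add : forall (s t : R) f, 0 <= s -> 0 <= t -> L2 mu f ->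
    S (s + t) f = S s (S t f) %[ae mu] ;
  sg_continuous : forall f, L2 mu f ->
    L2dist mu (S t f) f @[t --> 0^'+] --> 0%E }.

(* S_t = exp(- t H): S is a strongly continuous semigroup, and -H is its
   infinitesimal generator, that is,
   H f = g iff t^-1 (f - S_t f) converges to g in L_2 as t -> 0+. *)
Definition semigroup_generated_by (H : (T -> R[i]) -> (T -> R[i]) -> Prop) S :
    Prop :=
  C0_semigroup S /\
  forall f g, L2 mu f -> L2 mu g ->
    (H f g <->
     L2dist mu (cst (t^-1)%:C \* (f \- S t f)) g
       @[t --> 0^'+] --> 0%E).

End semigroups.

Notation borel X := (g_sigma_algebraType (@open X)).

Section set_theoretic_distance.
Context {X : ptopologicalType} {R : realType}.
Variable mu : {measure set (borel X) -> \bar R}.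
Variable E : L2form (borel X) R.
Implicit Types (psi phi : borel X -> R).

Definition essupp {V : zmodType} (f : borel X -> V) : set X :=
  ~` \bigcup_(U in [set U : set X | open U /\ f = cst 0 %[ae mu in U]]) U.

(* On a space that is not hereditarily Lindelof, an arbitrary Borel measure
   may charge the complement of essupp f where f does not vanish (every compact
   set, or even every point, may have a null neighbourhood).  The second
   conjunct says that f is carried by its support; it is automatic when X is
   hereditarily Lindelof or mu is a Radon measure.  The independence of energy_hat of the
   choice of its extension relies on it. *)
Definition compactly_supported {V : zmodType} (f : borel X -> V) : Prop :=
  compact (essupp f) /\ f = cst 0 %[ae mu in ~` essupp f].

Definition Linfty_c : set (borel X -> R[i]) :=
  [set f | Lp mu +oo%E f /\ compactly_supported f].

Definition Linfty_c_real : set (borel X -> R) :=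
  [set phi | Linfty_real mu phi /\ compactly_supported phi].

Definition dom_loc : set (borel X -> R[i]) :=
  [set f : borel X -> R[i] | cmeasurable f /\
    forall K : set X, compact K -> exists2 g, dom E g & f = g %[ae mu in K]].

(* The value is independent of the extension g of psi selected by xget when E is
   local. *)
Definition energy_hat psi phi : R[i] :=
  energy E
    (xget (cst 0) [set g : borel X -> R | [/\ dom E (cplx g), Linfty_real mu g
                              & psi = g %[ae mu in essupp phi]]])
    phi.

Definition energy_hat_norm psi : \bar R :=
  ereal_sup [set (normc (energy_hat psi phi))%:E | phi in
    [set phi | [/\ dom E (cplx phi), Linfty_c_real phi
                 & ('N[mu]_1[EFin \o phi] <= 1)%E]]].

Definition dom0 : set (borel X -> R) :=
  [set psi | [/\ dom_loc (cplx psi), Linfty_real mu psi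
               & (energy_hat_norm psi <= 1)%E]].

Definition set_distance (A B : set X) : \bar R :=
  ereal_sup [set gap mu psi A B | psi in dom0].

End set_theoretic_distance.

(* Main.v *)
(* All four conditions are equivalent to the invariance of the form domain under
   multiplication by the indicator of A.  If one S_t leaves L_2(A) invariant, it
   commutes with the projection P onto L_2(A); taking square roots, so do all
   S_{t/2^n}, hence P commutes with the generator, and P does not increase the
   energy on its domain; lower semicontinuity of the closed form gives
   P D(E) <= D(E).  Conversely, if P D(E) <= D(E) then E(P f, (1 - P) g) = 0 by
   locality, so P commutes with H, and the energy inequality for
   |(1 - P) S_t f|^2 gives the invariance of L_2(A) for all t.
   On the side of the distance, the functions n 1_A are then locally in D(E) and
   have zero energy by locality, so that the distance is infinite; and a function
   psi in D_0(E) separating A from its complement yields 1_A locally in D(E) by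
   clipping, whence P preserves the core of bounded compactly supported elements
   (bounded elements of D(E) form an algebra), and then D(E).  *)
Require Import Defs.
From HB Require Import structures.
From mathcomp Require Import all_boot all_order all_algebra.
From mathcomp Require Import all_classical all_reals all_analysis.
From mathcomp Require Import ess_sup_inf measurable_realfun complex ring lra.

Set Implicit Arguments.
Unset Strict Implicit.
Unset Printing Implicit Defensive.

Import Order.TTheory GRing.Theory Num.Theory.
Import numFieldNormedType.Exports.

Local Open Scope classical_set_scope.
Local Open Scope ring_scope.

(** The definition of the semigroup gives only strong continuity, a bound for each [S t] that may
    depend on t, and the generator [-H]. Contractivity, symmetry and positivity are therefore
    derived from the generator relation. Derivatives in t are replaced by telescoping over small
    time steps, and the bounds that this requires come from a Baire-type argument on the form
    domain. The spectral theorem is avoided: square roots enter only through an iteration of F.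
    Riesz, which shows that a symmetric linear map commuting with the square of an injective
    positive contraction commutes with the contraction itself. Weak compactness is avoided as well:
    almost minimisation over decreasing convex sets, in the graph norm, yields both the resolvent
    and lower semicontinuity. All of this takes place over the reals, for the real part of the inner
    product on classes of functions; the complex operator is recovered by means of the test
    functions ['i * h]. *)

Lemma discriminant_le (R : realFieldType) (p q r : R) :
  (forall a, 0 <= p + 2 * a * q + a ^+ 2 * r) -> q ^+ 2 <= p * r.
Proof.
move=> H.
have [r0|r0|r0] := ltgtP r 0.
- have [q0|q0] := eqVneq q 0.
    have p0 := H 0; rewrite !(mulr0, mul0r, expr0n, addr0) /= in p0.
    have r1 : 0 < - r by rewrite oppr_gt0.
    have := H ((p + 1) / (- r) + 1).
    set t := (p + 1) / (- r) => Ht.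
    have tr : t * r = - (p + 1).
      by rewrite /t; field; rewrite lt_eqF.
    have t0 : 0 <= t by rewrite divr_ge0 //; lra.
    rewrite q0; nra.
  have p0 := H 0; rewrite !(mulr0, mul0r, expr0n, addr0) /= in p0.
  (* Adding the values at two opposite points cancels q and leaves [2 * (p + a ^+ 2 * r)], which is
     negative for this a: the case is absurd. *)
  have Ha := H ((p + 1) / (- r) + 1).
  have Hb := H (- ((p + 1) / (- r) + 1)).
  move: Ha Hb; set t := (p + 1) / (- r) => Ha Hb.
  have tr : t * r = - (p + 1).
    by rewrite /t; field; rewrite lt_eqF.
  have t0 : 0 <= t by rewrite divr_ge0 //; lra.
  nra.
- have := H (- (q / r)) => Ha.
  have -> : p * r = (p + 2 * - (q / r) * q + (- (q / r)) ^+ 2 * r) * r + q ^+ 2.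
    by field; rewrite gt_eqF.
  by rewrite lerDr mulr_ge0 // ltW.
- rewrite r0 mulr0; have [->|q0] := eqVneq q 0; first by rewrite expr0n.
  have := H (- (p + 1) / (2 * q)); rewrite r0 mulr0 addr0.
  have -> : p + 2 * (- (p + 1) / (2 * q)) * q = - 1.
    by field.
  lra.
Qed.

Lemma natSinv_lt (R : realType) (e : R) : 0 < e ->
  exists N : nat, forall n, (N <= n)%N -> n.+1%:R^-1 < e.
Proof.
move=> e0; exists (Num.truncn e^-1) => n Nn.
rewrite -[ltRHS]invrK ltf_pV2 ?posrE ?invr_gt0 ?ltr0Sn //.
by apply: (lt_le_trans (truncnS_gt _)); rewrite ler_nat ltnS.
Qed.

Lemma le_eps (R : realFieldType) (x y : R) :
  (forall e : R, 0 < e -> x <= y + e) -> x <= y.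
Proof. by move=> xy; apply/ler_addgt0Pr. Qed.

Lemma eq0_eps (R : realFieldType) (x : R) :
  0 <= x -> (forall e : R, 0 < e -> x <= e) -> x = 0.
Proof.
move=> x0 xe; apply/eqP; rewrite eq_le x0 andbT.
by apply/ler_addgt0Pr => e e0; rewrite add0r xe.
Qed.

(** * Positive semidefinite symmetric forms on a subspace *)

(** One notion serves for the inner product (with domain [setT]), the energy, the graph form, and
    the form [ip (C x) y] of a positive operator [C]. *)
Record psd_form {R : realType} {V : lmodType R} (D : set V) (b : V -> V -> R)
  : Prop := PsdForm {
  psd_dom0 : D 0 ;
  psd_domP : forall a x y, D x -> D y -> D (a *: x + y) ;
  psd_sym : forall x y, D x -> D y -> b x y = b y x ;
  psd_linear : forall a x y z, D x -> D y -> D z ->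
    b (a *: x + y) z = a * b x z + b y z ;
  psd_ge0 : forall x, D x -> 0 <= b x x }.

Section psd_forms.
Context {R : realType} {V : lmodType R}.
Variables (D : set V) (b : V -> V -> R).
Hypothesis Db : psd_form D b.

Let D0 := psd_dom0 Db.
Let DP := psd_domP Db.

Lemma psd_domD x y : D x -> D y -> D (x + y).
Proof. by move=> Dx Dy; rewrite -[x]scale1r; exact: DP. Qed.

Lemma psd_domZ a x : D x -> D (a *: x).
Proof. by move=> Dx; rewrite -[_ *: _]addr0; exact: DP. Qed.

Lemma psd_domN x : D x -> D (- x).
Proof. by move=> Dx; rewrite -scaleN1r; exact: psd_domZ. Qed.

Lemma psd_domB x y : D x -> D y -> D (x - y).
Proof. by move=> Dx Dy; apply: psd_domD => //; exact: psd_domN. Qed.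

Lemma psd_addl x y z : D x -> D y -> D z -> b (x + y) z = b x z + b y z.
Proof. by move=> Dx Dy Dz; rewrite -[x]scale1r (psd_linear Db) ?scale1r // mul1r. Qed.

Lemma psd_0l z : D z -> b 0 z = 0.
Proof.
by move=> Dz; have := psd_addl D0 D0 Dz; rewrite addr0; lra.
Qed.

Lemma psd_scalel a x z : D x -> D z -> b (a *: x) z = a * b x z.
Proof. by move=> Dx Dz; rewrite -[_ *: _]addr0 (psd_linear Db) // psd_0l // addr0. Qed.

Lemma psd_subl x y z : D x -> D y -> D z -> b (x - y) z = b x z - b y z.
Proof.
move=> Dx Dy Dz; rewrite psd_addl //; last exact: psd_domN.
by rewrite -scaleN1r psd_scalel // mulN1r.
Qed.

Lemma psd_addr x y z : D x -> D y -> D z -> b x (y + z) = b x y + b x z.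
Proof.
move=> Dx Dy Dz; rewrite (psd_sym Db) //; last exact: psd_domD.
by rewrite psd_addl // (psd_sym Db Dy Dx) (psd_sym Db Dz Dx).
Qed.

Lemma psd_scaler a x z : D x -> D z -> b x (a *: z) = a * b x z.
Proof.
move=> Dx Dz; rewrite (psd_sym Db) //; last exact: psd_domZ.
by rewrite psd_scalel // (psd_sym Db Dz Dx).
Qed.

Lemma psd_subr x y z : D x -> D y -> D z -> b x (y - z) = b x y - b x z.
Proof.
move=> Dx Dy Dz; rewrite (psd_sym Db) //; last exact: psd_domB.
by rewrite psd_subl // (psd_sym Db Dy Dx) (psd_sym Db Dz Dx).
Qed.

Lemma psd_expand a x y : D x -> D y ->
  b (x + a *: y) (x + a *: y) = b x x + 2 * a * b x y + a ^+ 2 * b y y.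
Proof.
move=> Dx Dy; have Dz := psd_domZ a Dy.
rewrite psd_addl ?psd_addr ?psd_scalel ?psd_scaler //; last exact: psd_domD.
by rewrite (psd_sym Db Dy Dx); ring.
Qed.

Lemma psd_CauchySchwarz x y : D x -> D y -> b x y ^+ 2 <= b x x * b y y.
Proof.
move=> Dx Dy; apply: discriminant_le => a; rewrite -psd_expand //.
by apply: (psd_ge0 Db); apply: psd_domD => //; exact: psd_domZ.
Qed.

Lemma psd_expandD x y : D x -> D y ->
  b (x + y) (x + y) = b x x + 2 * b x y + b y y.
Proof. by move=> Dx Dy; rewrite -[y]scale1r psd_expand // ?scale1r; ring. Qed.

Lemma psd_expandB x y : D x -> D y ->
  b (x - y) (x - y) = b x x - 2 * b x y + b y y.
Proof. by move=> Dx Dy; rewrite -scaleN1r psd_expand //; ring. Qed.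

Lemma psd_midpoint x y : D x -> D y ->
  b (2^-1 *: (x + y)) (2^-1 *: (x + y))
    = (b x x + b y y) / 2 - b (x - y) (x - y) / 4.
Proof.
move=> Dx Dy; have Dxy := psd_domD Dx Dy.
rewrite psd_scalel ?psd_scaler ?psd_expandB ?psd_expandD //; last exact: psd_domZ.
by field.
Qed.

Lemma psd_midpoint_le x y : D x -> D y ->
  b (2^-1 *: (x + y)) (2^-1 *: (x + y)) <= (b x x + b y y) / 2.
Proof.
move=> Dx Dy; rewrite psd_midpoint // lerBlDr lerDl divr_ge0 //.
by apply: (psd_ge0 Db); exact: psd_domB.
Qed.

Lemma psd_addle x y : D x -> D y ->
  b (x + y) (x + y) <= 2 * (b x x + b y y).
Proof.
move=> Dx Dy; have := psd_ge0 Db (psd_domB Dx Dy).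
by rewrite psd_expandB ?psd_expandD //; lra.
Qed.

Lemma psd_suble x y : D x -> D y ->
  b (x - y) (x - y) <= 2 * (b x x + b y y).
Proof.
move=> Dx Dy; have := psd_ge0 Db (psd_domD Dx Dy).
by rewrite psd_expandB ?psd_expandD //; lra.
Qed.

(** Minkowski's inequality for the seminorm of [b], kept in squared form so that energy bounds add
    up without square roots. *)
Lemma psd_add_sqr (s r c : R) x y : D x -> D y -> 0 <= s -> 0 <= r -> 0 <= c ->
  b x x <= s ^+ 2 * c -> b y y <= r ^+ 2 * c ->
  b (x + y) (x + y) <= (s + r) ^+ 2 * c.
Proof.
move=> Dx Dy s0 r0 c0 Hx Hy; rewrite psd_expandD //.
suff : b x y <= s * r * c by nra.
have src0 : 0 <= s * r * c by rewrite !mulr_ge0.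
have [bxy0|bxy0] := ler0P (b x y); first exact: le_trans src0.
rewrite -(@ler_sqr _ (b x y)) ?nnegrE ?(ltW bxy0) //.
apply: (le_trans (psd_CauchySchwarz Dx Dy)).
have -> : (s * r * c) ^+ 2 = (s ^+ 2 * c) * (r ^+ 2 * c) by ring.
by apply: ler_pM => //; exact: (psd_ge0 Db).
Qed.

End psd_forms.

(** * Graph norm, completeness and convex minimisation *)

Section closed_forms.
Context {R : realType} {V : lmodType R}.
Variables (ip : V -> V -> R) (D : set V) (E : V -> V -> R).
Hypothesis ipH : psd_form setT ip.
Hypothesis ip_def : forall x, ip x x = 0 -> x = 0.
Hypothesis EH : psd_form D E.

Definition graph_form (x y : V) : R := E x y + ip x y.

Lemma graph_form_psd : psd_form D graph_form.
Proof.
split.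
- exact: psd_dom0 EH.
- exact: psd_domP EH.
- by move=> x y Dx Dy; rewrite /graph_form (psd_sym EH) // (psd_sym ipH).
- move=> a x y z Dx Dy Dz; rewrite /graph_form (psd_linear EH) //.
  by rewrite (psd_linear ipH) //; ring.
- by move=> x Dx; rewrite addr_ge0 // ?(psd_ge0 EH) // (psd_ge0 ipH).
Qed.

Let q := graph_form.
Let qH := graph_form_psd.

Lemma form_le_graph x : D x -> E x x <= q x x.
Proof. by move=> Dx; rewrite lerDl (psd_ge0 ipH). Qed.

Lemma ip_le_graph x : D x -> ip x x <= q x x.
Proof. by move=> Dx; rewrite lerDr (psd_ge0 EH). Qed.

Definition complete_form := forall f : nat -> V, (forall n, D (f n)) ->
  (forall e : R, 0 < e -> exists N : nat, forall m n, (N <= m)%N -> (N <= n)%N ->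
     q (f m - f n) (f m - f n) < e) ->
  exists2 g, D g & forall e : R, 0 < e -> exists N : nat, forall n, (N <= n)%N ->
     q (f n - g) (f n - g) < e.

Hypothesis complete_E : complete_form.

(* Almost minimisers of the norm over decreasing convex sets form a Cauchy
   sequence, by the parallelogram law. *)
Lemma convex_selection (C : nat -> set V) (M : R) :
  (forall n, C n `<=` D) -> (forall n, C n.+1 `<=` C n) ->
  (forall n x y, C n x -> C n y -> C n (2^-1 *: (x + y))) ->
  (forall n, exists2 x, C n x & q x x <= M) ->
  exists g : nat -> V, exists h, [/\ forall n, C n (g n), D h &
    forall e : R, 0 < e -> exists N : nat, forall n, (N <= n)%N ->
      q (g n - h) (g n - h) < e].
Proof.
move=> CD Cdec Cmid Cne.
have CdecW : forall m n, (m <= n)%N -> C n `<=` C m.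
  move=> m n /subnK <-; elim: (n - m)%N => [//|k IH].
  by rewrite addSn; exact: subset_trans IH.
pose Q n := [set q x x | x in C n].
have Qinf n : has_inf (Q n).
  split; first by have [x Cx _] := Cne n; exists (q x x); exists x.
  by exists 0 => _ [x Cx <-]; apply: (psd_ge0 qH); exact: CD Cx.
pose mm n : R := inf (Q n).
have mm_le n x : C n x -> mm n <= q x x.
  by move=> Cx; apply: ge_inf; [exact: (Qinf n).2 | exists x].
have mmM n : mm n <= M.
  by have [x Cx xM] := Cne n; exact: le_trans (mm_le _ _ Cx) xM.
pose r n : R := n.+1%:R^-1.
have /(_ _)/cid-/all_sig[g gP] n : exists x, C n x /\ q x x < mm n + r n.
  have [|_ [x Cx <-] Hx] := @inf_adherent _ (Q n) (r n) _ (Qinf n).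
    by rewrite invr_gt0.
  by exists x.
have Msup : has_sup (range mm).
  by split; [exists (mm 0%N); exists 0%N | exists M => _ [n _ <-]].
pose m : R := sup (range mm).
have mm_m n : mm n <= m by apply: (ub_le_sup Msup.2); exists n.
have cau : forall e : R, 0 < e -> exists N : nat, forall k n, (N <= k)%N ->
    (N <= n)%N -> q (g k - g n) (g k - g n) < e.
  move=> e e0.
  (* Both values [q (g k) (g k)] and [q (g n) (g n)] lie below [m + e / 4], in fact within [e / 8]
     above [m], and the midpoint has value above [m - e / 8]; the parallelogram law leaves
     [q (g k - g n) (g k - g n) / 4 < e / 4]. *)
  have e8 : 0 < e / 8 by rewrite divr_gt0.
  have [_ [N1 _ <-] HN1] := sup_adherent e8 Msup.
  have [N2 HN2] : exists N : nat, forall n, (N <= n)%N -> r n < e / 8.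
    exact: natSinv_lt.
  exists (maxn N1 N2) => k n; rewrite !geq_max => /andP[k1 k2] /andP[n1 n2].
  have := psd_midpoint qH (CD _ _ (gP k).1) (CD _ _ (gP n).1).
  have : mm N1 <= q (2^-1 *: (g k + g n)) (2^-1 *: (g k + g n)).
    apply/mm_le/Cmid; first exact: CdecW (gP k).1.
    exact: CdecW (gP n).1.
  have := (gP k).2; have := (gP n).2; have := HN2 _ k2; have := HN2 _ n2.
  have := mm_m k; have := mm_m n; move: HN1; rewrite -/m -/q.
  lra.
have [h Dh hP] := complete_E (fun n => CD _ _ (gP n).1) cau.
by exists g, h; split => // n; exact: (gP n).1.
Qed.

End closed_forms.

(** * Closed forms on a Hilbert space *)

Record hilbert_form {R : realType} {V : lmodType R} (ip : V -> V -> R)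
    (D : set V) (E : V -> V -> R) : Prop := HilbertForm {
  hf_ip : psd_form setT ip ;
  hf_def : forall x, ip x x = 0 -> x = 0 ;
  hf_form : psd_form D E ;
  hf_complete : complete_form ip D E ;
  hf_dense : forall f (e : R), 0 < e ->
    exists2 g, D g & ip (f - g) (f - g) < e }.

Section hilbert_forms.
Context {R : realType} {V : lmodType R}.
Variables (ip : V -> V -> R) (D : set V) (E : V -> V -> R).
Hypothesis HE : hilbert_form ip D E.

Let ipH := hf_ip HE.
Let EH := hf_form HE.
Let q := graph_form ip E.

Lemma ip_sym x y : ip x y = ip y x. Proof. exact: (psd_sym ipH). Qed.
Lemma ip_ge0 x : 0 <= ip x x. Proof. exact: (psd_ge0 ipH). Qed.
Lemma ip_addl x y z : ip (x + y) z = ip x z + ip y z.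
Proof. exact: (psd_addl ipH). Qed.
Lemma ip_addr x y z : ip x (y + z) = ip x y + ip x z.
Proof. exact: (psd_addr ipH). Qed.
Lemma ip_subl x y z : ip (x - y) z = ip x z - ip y z.
Proof. exact: (psd_subl ipH). Qed.
Lemma ip_subr x y z : ip x (y - z) = ip x y - ip x z.
Proof. exact: (psd_subr ipH). Qed.
Lemma ip_scalel a x z : ip (a *: x) z = a * ip x z.
Proof. exact: (psd_scalel ipH). Qed.
Lemma ip_scaler a x z : ip x (a *: z) = a * ip x z.
Proof. exact: (psd_scaler ipH). Qed.
Lemma ip_0l x : ip 0 x = 0. Proof. exact: (psd_0l ipH). Qed.
Lemma ip_oppl x y : ip (- x) y = - ip x y.
Proof. by rewrite -scaleN1r ip_scalel mulN1r. Qed.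
Lemma ip_oppr x y : ip x (- y) = - ip x y.
Proof. by rewrite ip_sym ip_oppl ip_sym. Qed.
Lemma ip_distC x y : ip (x - y) (x - y) = ip (y - x) (y - x).
Proof. by rewrite !ip_subl !ip_subr; ring. Qed.

Lemma ip_ext x y : (forall z, ip x z = ip y z) -> x = y.
Proof.
move=> xy; apply/eqP; rewrite -subr_eq0; apply/eqP/(hf_def HE).
by rewrite ip_subl xy subrr.
Qed.

Definition nrm x : R := Num.sqrt (ip x x).

Lemma nrm_ge0 x : 0 <= nrm x. Proof. exact: sqrtr_ge0. Qed.
Lemma nrm_sqr x : nrm x ^+ 2 = ip x x. Proof. by rewrite sqr_sqrtr // ip_ge0. Qed.
Lemma nrm0 : nrm 0 = 0. Proof. by rewrite /nrm ip_0l sqrtr0. Qed.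
Lemma nrm_eq0 x : nrm x = 0 -> x = 0.
Proof. by move=> x0; apply: (hf_def HE); rewrite -nrm_sqr x0 expr0n. Qed.

Lemma ip_le_nrm x y : `|ip x y| <= nrm x * nrm y.
Proof.
rewrite -ler_sqr ?nnegrE ?mulr_ge0 ?nrm_ge0 // real_normK ?num_real //.
by rewrite exprMn !nrm_sqr (psd_CauchySchwarz ipH).
Qed.

Lemma nrmD x y : nrm (x + y) <= nrm x + nrm y.
Proof.
rewrite -ler_sqr ?nnegrE ?addr_ge0 ?nrm_ge0 // nrm_sqr (psd_expandD ipH) //.
have := le_trans (ler_norm _) (ip_le_nrm x y).
by rewrite -!nrm_sqr; nra.
Qed.

Lemma nrmZ a x : nrm (a *: x) = `|a| * nrm x.
Proof.
by rewrite /nrm ip_scalel ip_scaler mulrA -expr2 sqrtrM ?sqr_ge0 // sqrtr_sqr.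
Qed.

Lemma nrmN x : nrm (- x) = nrm x.
Proof. by rewrite -scaleN1r nrmZ normrN1 mul1r. Qed.

Lemma nrmB x y : nrm (x - y) <= nrm x + nrm y.
Proof. by rewrite -(nrmN y) nrmD. Qed.

Lemma nrm_distC x y : nrm (x - y) = nrm (y - x).
Proof. by rewrite -nrmN opprB. Qed.

Lemma nrm_lt x (e : R) : 0 < e -> ip x x < e ^+ 2 -> nrm x < e.
Proof.
move=> e0 xe; rewrite -ltr_sqr ?nnegrE ?nrm_ge0 ?(ltW e0) //.
by rewrite nrm_sqr.
Qed.

Lemma nrm_eps0 x : (forall e : R, 0 < e -> nrm x <= e) -> x = 0.
Proof.
by move=> H; apply: nrm_eq0; apply: eq0_eps => //; exact: nrm_ge0.
Qed.

Lemma form_dense f (e : R) : 0 < e -> exists2 g, D g & nrm (f - g) < e.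
Proof.
move=> e0; have [g Dg ge] := hf_dense HE f (exprn_gt0 2 e0).
by exists g => //; exact: nrm_lt.
Qed.

(** The points of energy at most [C] and of squared distance at most [n.+1%:R^-1] from [x] form
    decreasing convex sets that meet a fixed ball of the graph norm. The sequence selected from them
    converges in the graph norm to some h in [D], and in V to [x]; hence [x = h]. *)
Lemma form_lsc x (C : R) :
  (forall e : R, 0 < e -> exists2 u, D u & E u u <= C /\ ip (u - x) (u - x) <= e) ->
  D x.
Proof.
move=> H.
pose r n : R := n.+1%:R^-1.
have r0 n : 0 < r n by rewrite invr_gt0.
have r1 n : r n <= 1 by rewrite invf_le1 // ler1n.
have rS n : r n.+1 <= r n by rewrite lef_pV2 ?posrE // ler_nat.
pose Cn n := [set u | [/\ D u, E u u <= C & ip (u - x) (u - x) <= r n]].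
have [] := @convex_selection _ _ ip D E ipH EH (hf_complete HE) Cn
  (C + 2 * (1 + ip x x)).
- by move=> n u [].
- by move=> n u [Du Eu ux]; split => //; exact: le_trans ux _.
- move=> n u v [Du Eu ux] [Dv Ev vx]; split.
  + exact/(psd_domZ EH)/(psd_domD EH).
  + by apply: le_trans (psd_midpoint_le EH Du Dv) _; lra.
  + have -> : 2^-1 *: (u + v) - x = 2^-1 *: ((u - x) + (v - x)).
      rewrite addrACA -opprD scalerBr -mulr2n -[in x *+ 2](scaler_nat 2 x).
      by rewrite scalerA mulVf ?scale1r // pnatr_eq0.
    by apply: le_trans (psd_midpoint_le ipH _ _) _ => //; lra.
- move=> n; have [u Du [Eu ux]] := H _ (r0 n); exists u => //.
  have := @psd_addle _ _ _ _ ipH (u - x) x I I; rewrite subrK /graph_form.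
  by have := r1 n; lra.
move=> g [h [gC Dh gh]].
suff -> : x = h by [].
apply/eqP; rewrite -subr_eq0; apply/eqP/(hf_def HE).
apply: eq0_eps => [|e e0]; first exact: ip_ge0.
have e4 : 0 < e / 4 by rewrite divr_gt0.
have [N1 HN1] := gh _ e4; have [N2 HN2] := natSinv_lt e4.
pose n := maxn N1 N2.
have [Dg Eg gx] := gC n.
have := HN1 n (leq_maxl _ _); have := HN2 n (leq_maxr _ _).
rewrite -/(r n) => rn gn.
have := @psd_addle _ _ _ _ ipH (x - g n) (g n - h) I I; rewrite addrA subrK.
have := ip_le_graph ip EH (psd_domB EH Dg Dh).
by rewrite (ip_distC x); move: gn gx rn; rewrite -/q; lra.
Qed.

(** The identity is the Euler-Lagrange equation of [J u = eps * E u u + ip (u - f) (u - f)]. Almost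
    minimisers of [J] converge in the graph norm and satisfy the equation up to a vanishing error,
    so it passes to the limit. *)
Lemma resolvent_exists (eps : R) f : 0 < eps ->
  exists2 u, D u & forall h, D h -> eps * E u h + ip u h = ip f h.
Proof.
move=> eps0.
pose J u : R := eps * E u u + ip (u - f) (u - f).
have J0 u : D u -> 0 <= J u.
  by move=> Du; rewrite addr_ge0 ?ip_ge0 // mulr_ge0 ?(ltW eps0) ?(psd_ge0 EH).
pose m : R := inf [set J u | u in D].
have minf : has_inf [set J u | u in D].
  split; first by exists (J 0), 0; rewrite //; exact: psd_dom0 EH.
  by exists 0 => _ [u Du <-]; exact: J0.
have mJ u : D u -> m <= J u by move=> Du; apply: ge_inf; [exact: minf.2|exists u].
pose r n : R := n.+1%:R^-1.
have r0 n : 0 < r n by rewrite invr_gt0.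
have r1 n : r n <= 1 by rewrite invf_le1 // ler1n.
have rS n : r n.+1 <= r n by rewrite lef_pV2 ?posrE // ler_nat.
pose Cn n := [set u | D u /\ J u <= m + r n].
have [] := @convex_selection _ _ ip D E ipH EH (hf_complete HE) Cn
  ((m + 1) / eps + 2 * (m + 1 + ip f f)).
- by move=> n u [].
- by move=> n u [Du Ju]; split => //; apply: le_trans Ju _; rewrite lerD2l.
- move=> n u v [Du Ju] [Dv Jv]; split.
    exact/(psd_domZ EH)/(psd_domD EH).
  have -> : J (2^-1 *: (u + v)) = eps * E (2^-1 *: (u + v)) (2^-1 *: (u + v)) +
      ip (2^-1 *: ((u - f) + (v - f))) (2^-1 *: ((u - f) + (v - f))).
    congr (_ + ip _ _);
    rewrite addrACA -opprD scalerBr -mulr2n -[in f *+ 2](scaler_nat 2 f);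
    by rewrite scalerA mulVf ?scale1r // pnatr_eq0.
  have := psd_midpoint_le ipH (I : setT (u - f)) (I : setT (v - f)).
  have := psd_midpoint_le EH Du Dv.
  move: Ju Jv; rewrite /J; nra.
- move=> n; have [_ [u Du <-] Ju] := inf_adherent (r0 n) minf.
  exists u; first by split => //; exact: ltW.
  have := @psd_addle _ _ _ _ ipH (u - f) f I I; rewrite subrK /graph_form.
  have EJ : E u u <= (m + 1) / eps.
    rewrite ler_pdivlMr // mulrC; have := ip_ge0 (u - f); have := r1 n.
    by move: Ju; rewrite -/m /J; lra.
  have := r1 n; have := psd_ge0 EH Du.
  by move: Ju; rewrite -/m /J; nra.
move=> g [u [gC Du gu]]; exists u => // h Dh.
pose L v : R := eps * E v h + ip (v - f) h.
pose K : R := eps * E h h + ip h h.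
have K0 : 0 <= K.
  by rewrite addr_ge0 ?ip_ge0 // mulr_ge0 ?(ltW eps0) ?(psd_ge0 EH).
have Lg n : L (g n) ^+ 2 <= r n * K.
  have [Dg Jg] := gC n; apply: discriminant_le => a.
  have Dah : D (g n + a *: h) by apply: (psd_domD EH) => //; exact: psd_domZ EH _ _ Dh.
  have := mJ _ Dah; rewrite /J (psd_expand EH) //.
  rewrite (addrAC (g n)) (psd_expand ipH) //.
  by move: Jg; rewrite /J /L /K; lra.
have LD n : L u = L (g n) - (eps * E (g n - u) h + ip (g n - u) h).
  have [Dg _] := gC n.
  by rewrite /L (psd_subl EH) // !ip_subl; ring.
suff : L u = 0.
  by rewrite /L ip_subl; lra.
apply/eqP; rewrite -sqrf_eq0; apply/eqP.
apply: eq0_eps => [|e e0]; first exact: sqr_ge0.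
pose B : R := 1 + K + eps ^+ 2 * E h h + ip h h.
have Ehh := psd_ge0 EH Dh; have ihh := ip_ge0 h.
have B0 : 0 < B by rewrite /B; nra.
have eB : 0 < e / (8 * B) by rewrite divr_gt0 // mulr_gt0.
have [N1 HN1] := gu _ eB; have [N2 HN2] := natSinv_lt eB.
pose n := maxn N1 N2.
have [Dg _] := gC n.
have := HN1 n (leq_maxl _ _); have := HN2 n (leq_maxr _ _).
rewrite -/(r n) => rn gn.
have Dgu := psd_domB EH Dg Du.
have := Lg n.
have := psd_CauchySchwarz EH Dgu Dh.
have := psd_CauchySchwarz ipH (I : setT (g n - u)) (I : setT h).
have := le_lt_trans (form_le_graph E ipH Dgu) gn.
have := le_lt_trans (ip_le_graph ip EH Dgu) gn.
have := psd_ge0 EH Dgu; have := ip_ge0 (g n - u).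
rewrite (LD n); set d := e / (8 * B) in eB rn *.
have dB : d * B = e / 8 by rewrite /d; field; rewrite gt_eqF.
move: (L (g n)) (E (g n - u) h) (ip (g n - u) h) (E (g n - u) (g n - u)) (ip (g n - u) (g n - u)).
move=> l a b A C C0 A0 Cd Ad bC aA lK.
have l1 : l ^+ 2 <= d * K by apply: le_trans lK _; rewrite ler_wpM2r // ltW.
have a1 : a ^+ 2 <= d * E h h by apply: le_trans aA _; rewrite ler_wpM2r // ltW.
have b1 : b ^+ 2 <= d * ip h h by apply: le_trans bC _; rewrite ler_wpM2r // ltW.
have a2 : eps ^+ 2 * a ^+ 2 <= eps ^+ 2 * (d * E h h).
  by rewrite ler_wpM2l // sqr_ge0.
apply: (@le_trans _ _ (4 * (l ^+ 2 + eps ^+ 2 * a ^+ 2 + b ^+ 2))).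
  have : 0 <= (l + eps * a) ^+ 2 by exact: sqr_ge0.
  have : 0 <= (l + b) ^+ 2 by exact: sqr_ge0.
  have : 0 <= (eps * a - b) ^+ 2 by exact: sqr_ge0.
  have := sqr_ge0 l; have := sqr_ge0 (eps * a); have := sqr_ge0 b.
  lra.
have : d * K + eps ^+ 2 * (d * E h h) + d * ip h h <= d * B by rewrite /B; lra.
lra.
Qed.

End hilbert_forms.

(** * Square roots of positive contractions *)

Definition lin {R : realType} {V : lmodType R} (f : V -> V) :=
  forall (a : R) x y, f (a *: x + y) = a *: f x + f y.

Section lin.
Context {R : realType} {V : lmodType R} (f : V -> V).
Hypothesis fL : lin f.

Lemma linD x y : f (x + y) = f x + f y.
Proof. by rewrite -[x]scale1r fL !scale1r. Qed.
Lemma lin0 : f 0 = 0.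
Proof. by apply: (@addIr _ (f 0)); rewrite -linD !add0r. Qed.
Lemma linZ a x : f (a *: x) = a *: f x.
Proof. by rewrite -[_ *: x]addr0 fL lin0 addr0. Qed.
Lemma linN x : f (- x) = - f x.
Proof. by rewrite -scaleN1r linZ scaleN1r. Qed.
Lemma linB x y : f (x - y) = f x - f y.
Proof. by rewrite linD linN. Qed.
End lin.

Section square_root.
Context {R : realType} {V : lmodType R}.
Variables (ip : V -> V -> R) (D : set V) (E : V -> V -> R).
Hypothesis HE : hilbert_form ip D E.

Let ipH := hf_ip HE.
Notation nrm := (nrm ip).

Record contractive_psd (C : V -> V) : Prop := ContractivePsd {
  cp_lin : lin C ;
  cp_sym : forall x y, ip (C x) y = ip x (C y) ;
  cp_ge0 : forall x, 0 <= ip (C x) x ;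
  cp_le1 : forall x, ip (C x) x <= ip x x }.

(** Cauchy-Schwarz for the form [ip (C x) y] at the points [x] and [C x], with [C <= 1] to bound
    [ip (C (C x)) (C x)]. *)
Lemma contractive_psd_sqr C x : contractive_psd C -> ip (C x) (C x) <= ip (C x) x.
Proof.
move=> CH.
have cH : psd_form setT (fun x y => ip (C x) y).
  split => // [u v _ _ | a u v w _ _ _ | u _]; last exact: cp_ge0.
  - by rewrite (cp_sym CH) (ip_sym HE).
  - by rewrite (cp_lin CH) (psd_linear ipH).
have /= := psd_CauchySchwarz cH (I : setT x) (I : setT (C x)).
have := cp_ge0 CH x; have := cp_le1 CH (C x); have := ip_ge0 HE (C x).
move: (ip (C x) (C x)) (ip (C x) x) (ip (C (C x)) (C x)) => a b c a0 ca b0.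
have [->|] := eqVneq a 0; first by rewrite b0.
move=> aN0; have {a0 aN0} a0 : 0 < a by rewrite lt_neqAle eq_sym aN0.
move=> H; rewrite -(ler_pM2r a0); apply: (le_trans _ (ler_wpM2l b0 ca)).
by rewrite -expr2.
Qed.

(** F. Riesz's iteration, by which the product of two commuting positive operators is shown to be
    positive. Each iterate is a polynomial in [B], so it commutes with every linear map that
    commutes with [B]. *)
Fixpoint riesz (B : V -> V) (n : nat) : V -> V :=
  if n is n.+1 then fun x => riesz B n x - riesz B n (riesz B n x) else B.

Lemma riesz_psd B n : contractive_psd B -> contractive_psd (riesz B n).
Proof.
move=> BH; elim: n => [//|n IH] /=; set C := riesz B n in IH *.
have CL := cp_lin IH.
split => [a x y|x y|x|x].
- by rewrite !CL scalerBr opprD addrACA.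
- by rewrite (ip_subl HE) (ip_subr HE) !(cp_sym IH).
- by rewrite (ip_subl HE) (cp_sym IH (C x)) subr_ge0 contractive_psd_sqr.
- rewrite (ip_subl HE) (cp_sym IH (C x)).
  by rewrite lerBlDr ler_wpDr ?(ip_ge0 HE) // cp_le1.
Qed.

Lemma riesz_commute B T n x : lin T -> (forall x, B (T x) = T (B x)) ->
  riesz B n (T x) = T (riesz B n x).
Proof.
move=> TL BT; elim: n x => [|n IH] x /=; first exact: BT.
by rewrite !IH (linB TL).
Qed.

(* B = B_0^2 + ... + B_{n-1}^2 + B_n, where B_{k+1} = B_k - B_k^2. *)
Lemma riesz_sum B n x y : contractive_psd B ->
  ip (B x) y = \sum_(k < n) ip (riesz B k x) (riesz B k y) + ip (riesz B n x) y.
Proof.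
move=> BH; elim: n => [|n IH]; first by rewrite big_ord0 add0r.
rewrite big_ord_recr /= IH (ip_subl HE) (cp_sym (riesz_psd n BH) (riesz B n x)).
by ring.
Qed.

(** By [riesz_sum] the squared norms of the iterates at [x] add up to at most [ip x x], so they
    cannot all be at least [e]. *)
Lemma riesz_small B x (e : R) : contractive_psd B -> 0 < e ->
  exists n, ip (riesz B n x) (riesz B n x) < e.
Proof.
move=> BH e0; apply: contrapT => /forallNP H.
pose n := (Num.truncn (ip x x / e)).+1.
have : ip x x < n%:R * e by rewrite -ltr_pdivrMr //; exact: truncnS_gt.
rewrite ltNge => /negP; apply.
apply: (le_trans _ (cp_le1 BH x)); rewrite (riesz_sum n x x BH).
rewrite -[leLHS]addr0 lerD ?(cp_ge0 (riesz_psd n BH)) //.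
rewrite mulr_natl -[X in _ *+ X]card_ord -sumr_const; apply: ler_sum => k _.
by rewrite leNgt; apply/negP/H.
Qed.

(** The commutator [C = B P - P B] is skew and anticommutes with [B], so [T = - C^2] is positive and
    commutes with [B]. Hence [B T >= 0], that is [ip (B (C x)) (C x) <= 0]. As [B] is positive,
    [B C = 0], and [C = 0] by injectivity. *)
Lemma commute_square_root B P : contractive_psd B ->
  (forall x, B x = 0 -> x = 0) -> lin P ->
  (forall x y, ip (P x) y = ip x (P y)) ->
  (forall x, B (B (P x)) = P (B (B x))) -> forall x, B (P x) = P (B x).
Proof.
move=> BH Binj PL Psym BBP x.
have BL := cp_lin BH.
pose C x := B (P x) - P (B x).
have CL : lin C.
  move=> a u v; rewrite /C !(BL, PL) scalerBr opprD addrACA //.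
have BC u : B (C u) = - C (B u).
  by rewrite /C (linB BL) BBP opprB.
have Cskew u v : ip (C u) v = - ip u (C v).
  rewrite /C (ip_subl HE) (ip_subr HE) (cp_sym BH) !Psym (cp_sym BH).
  by rewrite opprB.
pose T u := - C (C u).
have TL : lin T by move=> a u v; rewrite /T !CL scalerN opprD.
have BT u : B (T u) = T (B u).
  by rewrite /T (linN BL) BC BC (linN CL) opprK.
have ipT u v : ip u (T v) = ip (C u) (C v).
  by rewrite /T (ip_sym HE) (ip_oppl HE) Cskew opprK (ip_sym HE).
suff Cx0 : C x = 0 by apply/eqP; rewrite -subr_eq0 -/(C x) Cx0.
apply: Binj.
suff BCx : ip (B (C x)) (C x) <= 0.
  apply: (hf_def HE); apply/eqP; rewrite eq_le (ip_ge0 HE) andbT.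
  exact: le_trans (contractive_psd_sqr _ BH) BCx.
rewrite BC (ip_oppl HE) oppr_le0 -ipT.
rewrite -lerN2 oppr0; apply: le_eps => e e0; rewrite add0r.
have T1 : 0 < nrm (T x) + 1 by rewrite ltr_wpDl ?nrm_ge0.
have d0 : 0 < e / (nrm (T x) + 1) by rewrite divr_gt0.
have [n /(nrm_lt HE d0) Hn] := riesz_small x BH (exprn_gt0 2 d0).
(* The iterates commute with [T], so each summand is the squared norm of [C (riesz B k x)]; only the
   remainder costs [e]. *)
rewrite (riesz_sum n _ _ BH) opprD -[leRHS]add0r lerD //.
  rewrite oppr_le0 sumr_ge0 // => k _.
  by rewrite riesz_commute // ipT (ip_ge0 HE).
apply: (le_trans (ler_norm _)); rewrite normrN.
apply: (le_trans (ip_le_nrm HE _ _)).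
rewrite -(divfK (lt0r_neq0 T1) e); apply: ler_pM; rewrite ?nrm_ge0 ?(ltW Hn) //.
by rewrite lerDl.
Qed.

End square_root.

(** * The operator and the semigroup of a closed form *)

Section form_operator.
Context {R : realType} {V : lmodType R}.
Variables (ip : V -> V -> R) (D : set V) (E : V -> V -> R).
Hypothesis HE : hilbert_form ip D E.

Let ipH := hf_ip HE.
Let EH := hf_form HE.
Notation nrm := (nrm ip).
Let nrm_ge0 := nrm_ge0 ip.

Definition form_operator (x y : V) := D x /\ forall h, D h -> E x h = ip y h.

Notation G := form_operator.

Lemma op_lin a x y x' y' : G x y -> G x' y' -> G (a *: x + x') (a *: y + y').
Proof.
move=> [Dx Hx] [Dx' Hx']; split; first exact: (psd_domP EH).
by move=> h Dh; rewrite (psd_linear EH) // Hx // Hx' // (psd_linear ipH).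
Qed.

Lemma op_zero : G 0 0.
Proof.
split; first exact: psd_dom0 EH.
by move=> h Dh; rewrite (psd_0l EH) // (ip_0l HE).
Qed.

Lemma op_add x y x' y' : G x y -> G x' y' -> G (x + x') (y + y').
Proof. by move=> g g'; have := op_lin 1 g g'; rewrite !scale1r. Qed.

Lemma op_scale a x y : G x y -> G (a *: x) (a *: y).
Proof. by move=> g; have := op_lin a g op_zero; rewrite !addr0. Qed.

Lemma op_sub x y x' y' : G x y -> G x' y' -> G (x - x') (y - y').
Proof. by move=> g /(op_scale (-1)); rewrite !scaleN1r; exact: op_add. Qed.

Lemma op_sym x y x' y' : G x y -> G x' y' -> ip y x' = ip x y'.
Proof.
move=> [Dx Hx] [Dx' Hx']; rewrite -Hx // (psd_sym EH) // Hx' //.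
exact: (ip_sym HE).
Qed.

Lemma op_ge0 x y : G x y -> 0 <= ip x y.
Proof. by move=> [Dx Hx]; rewrite (ip_sym HE) -Hx // (psd_ge0 EH). Qed.

(** The estimates for [f] in [D] come from testing the resolvent equation with [u - f], which gives
    [eps * E u (u - f) = - ip (u - f) (u - f)], and from [0 <= E (u - f) (u - f)]. *)
Lemma op_resolvent (eps : R) f : 0 < eps -> exists u y, [/\ G u y,
  u + eps *: y = f & D f -> E u u <= E f f /\ ip (u - f) (u - f) <= eps * E f f].
Proof.
move=> eps0; have [u Du Hu] := resolvent_exists HE f eps0.
exists u, (eps^-1 *: (f - u)); split.
- split=> // h Dh; rewrite (ip_scalel HE) (ip_subl HE) -Hu // addrK mulrA.
  by rewrite mulVf ?mul1r // gt_eqF.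
- by rewrite scalerA divff ?scale1r ?subrKC // gt_eqF.
move=> Df; have Duf := psd_domB EH Du Df.
have := Hu _ Duf; rewrite (psd_subr EH) //.
have -> : ip u (u - f) = ip f (u - f) + ip (u - f) (u - f).
  by rewrite -(ip_addl HE) subrKC.
have := psd_ge0 EH Duf; rewrite (psd_expandB EH) //.
have := ip_ge0 HE (u - f); have := psd_ge0 EH Du; have := psd_ge0 EH Df.
by move: (E u u) (E u f) (E f f) (ip (u - f) (u - f)) => a b c d; nra.
Qed.

Lemma op_dense_form f (e : R) : D f -> 0 < e ->
  exists u y, [/\ G u y, E u u <= E f f & nrm (u - f) < e].
Proof.
move=> Df e0; have Ef := psd_ge0 EH Df.
have e1 : 0 < e ^+ 2 / (E f f + 1) by rewrite divr_gt0 ?exprn_gt0 // ltr_wpDl.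
have [u [y [Gu _ /(_ Df)[Eu uf]]]] := op_resolvent f e1.
exists u, y; split => //; apply: (nrm_lt HE) => //; apply: (le_lt_trans uf).
rewrite -mulrA -[ltRHS]mulr1 ltr_pM2l ?exprn_gt0 // mulrC ltr_pdivrMr ?ltr_wpDl //.
by rewrite mul1r ltrDl.
Qed.

Lemma op_dense f (e : R) : 0 < e -> exists u y, G u y /\ nrm (u - f) < e.
Proof.
move=> e0; have e2 : 0 < e / 2 by rewrite divr_gt0.
have [g Dg fg] := form_dense HE f e2.
have [u [y [Gu _ ug]]] := op_dense_form Dg e2.
exists u, y; split => //; have := nrmD HE (u - g) (g - f).
by rewrite subrKA (nrm_distC HE g); lra.
Qed.

(** If [g] is already in the domain of the operator, its resolvent [u] has image
    [y = d^-1 *: (g - u)], again in the domain. Two applications of the operator keep the Taylor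
    remainder in [sg_contraction] small in the graph norm. *)
Lemma op_dense2 f (e : R) : 0 < e ->
  exists u y z, [/\ G u y, G y z & nrm (u - f) < e].
Proof.
move=> e0; have e2 : 0 < e / 2 by rewrite divr_gt0.
have [g [g' [Gg gf]]] := op_dense f e2.
have Eg := psd_ge0 EH Gg.1.
have d0 : 0 < (e / 2) ^+ 2 / (E g g + 1).
  by rewrite divr_gt0 ?exprn_gt0 // ltr_wpDl.
have [u [y [Gu uy /(_ Gg.1)[Eu ug]]]] := op_resolvent g d0.
set d := (e / 2) ^+ 2 / (E g g + 1) in d0 uy ug.
have yE : y = d^-1 *: (g - u).
  by rewrite -uy addrC addKr scalerA mulVf ?scale1r // gt_eqF.
exists u, y, (d^-1 *: (g' - y)); split => //.
  by rewrite {1}yE; apply: op_scale; exact: op_sub.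
have : nrm (u - g) < e / 2.
  apply: (nrm_lt HE) => //; apply: (le_lt_trans ug).
  rewrite /d -mulrA -[ltRHS]mulr1 ltr_pM2l ?exprn_gt0 // mulrC.
  by rewrite ltr_pdivrMr ?ltr_wpDl // mul1r ltrDl.
have := nrmD HE (u - g) (g - f).
by rewrite subrKA; lra.
Qed.

End form_operator.

(** * Strongly continuous semigroups and local boundedness *)

Section semigroup.
Context {R : realType} {V : lmodType R}.
Variables (ip : V -> V -> R) (D : set V) (E : V -> V -> R).
Hypothesis HE : hilbert_form ip D E.

Let ipH := hf_ip HE.
Let EH := hf_form HE.
Let qH := graph_form_psd ipH EH.
Notation q := (graph_form ip E).
Notation nrm := (nrm ip).
Notation G := (form_operator ip D E).
Let nrm_ge0 := nrm_ge0 ip.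

Record semigroup_of (S : R -> V -> V) : Prop := SemigroupOf {
  sg_lin : forall t, 0 <= t -> lin (S t) ;
  sg_bdd : forall t, 0 <= t -> exists M : R, forall x, nrm (S t x) <= M * nrm x ;
  sg_0 : forall x, S 0 x = x ;
  sg_D : forall s t x, 0 <= s -> 0 <= t -> S (s + t) x = S s (S t x) ;
  sg_cont : forall x (e : R), 0 < e -> exists2 d : R, 0 < d &
    forall h : R, 0 < h -> h < d -> nrm (S h x - x) < e ;
  sg_gen : forall x y, G x y <-> forall e : R, 0 < e -> exists2 d : R, 0 < d &
    forall h : R, 0 < h -> h < d -> nrm (h^-1 *: (x - S h x) - y) < e }.

Variable S : R -> V -> V.
Hypothesis SH : semigroup_of S.

Lemma sg_bdd_pos t : 0 <= t ->
  exists2 M : R, 0 < M & forall x, nrm (S t x) <= M * nrm x.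
Proof.
move=> t0; have [M HM] := sg_bdd SH t0; exists (`|M| + 1).
  by rewrite ltr_wpDl.
move=> x; apply: le_trans (HM x) _; rewrite ler_wpM2r //.
by have := ler_norm M; lra.
Qed.

Lemma sg_comm s t x : 0 <= s -> 0 <= t -> S s (S t x) = S t (S s x).
Proof. by move=> s0 t0; rewrite -!(sg_D SH) // addrC. Qed.

Lemma sg_taylor x y (e : R) : G x y -> 0 < e -> exists2 d : R, 0 < d &
  forall h : R, 0 < h -> h < d -> nrm (S h x - x + h *: y) <= h * e.
Proof.
move=> /(sg_gen SH) Gxy e0; have [d d0 Hd] := Gxy _ e0; exists d => // h h0 hd.
have -> : S h x - x + h *: y = (- h) *: (h^-1 *: (x - S h x) - y).
  rewrite scalerBr scalerA mulNr divff ?gt_eqF // scaleN1r scaleNr opprB.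
  by rewrite opprK.
by rewrite (nrmZ HE) normrN gtr0_norm // ler_pM2l // ltW // Hd.
Qed.

Lemma sg_op t x y : 0 <= t -> G x y -> G (S t x) (S t y).
Proof.
move=> t0 /(sg_gen SH) Gxy; apply/(sg_gen SH) => e e0.
have [M M0 HM] := sg_bdd_pos t0.
have [d d0 Hd] := Gxy _ (divr_gt0 e0 M0); exists d => // h h0 hd.
have SL := sg_lin SH t0.
rewrite (sg_comm _ (ltW h0) t0) -(linB SL) -(linZ SL) -(linB SL).
apply: le_lt_trans (HM _) _.
by rewrite mulrC -ltr_pdivlMr // Hd.
Qed.

Let qn x : R := Num.sqrt (q x x).

Let qn_sqr x : D x -> qn x ^+ 2 = q x x.
Proof. by move=> Dx; rewrite sqr_sqrtr // (psd_ge0 qH). Qed.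

Let qn_ge0 x : 0 <= qn x. Proof. exact: sqrtr_ge0. Qed.

Let qnD x y : D x -> D y -> qn (x + y) <= qn x + qn y.
Proof.
move=> Dx Dy; rewrite -ler_sqr ?nnegrE ?addr_ge0 // qn_sqr; last first.
  exact: (psd_domD EH).
have := @psd_add_sqr _ _ _ _ qH (qn x) (qn y) 1 x y Dx Dy (qn_ge0 x) (qn_ge0 y).
by rewrite !mulr1 !qn_sqr //; apply.
Qed.

Let qnZ a x : D x -> qn (a *: x) = `|a| * qn x.
Proof.
move=> Dx; rewrite /qn (psd_scalel qH) ?(psd_scaler qH) //; last first.
  exact: (psd_domZ EH).
by rewrite mulrA -expr2 sqrtrM ?sqr_ge0 // sqrtr_sqr.
Qed.

Let nrm_le_qn x : D x -> nrm x <= qn x.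
Proof. by move=> Dx; rewrite ler_wsqrtr // (ip_le_graph ip EH). Qed.

Let qn_lt x (e : R) : D x -> 0 < e -> qn x < e -> q x x < e ^+ 2.
Proof. by move=> Dx e0 xe; rewrite -qn_sqr // ltr_sqr ?nnegrE // ltW. Qed.

(* The uniform boundedness principle on the complete space D, by nested
   balls; completeness of the ambient space V is never needed. *)
Lemma sg_locally_bounded : exists d M : R, [/\ 0 < d, 1 <= M &
  forall t x, 0 <= t -> t <= d -> D x -> nrm (S t x) <= M * qn x].
Proof.
apply: contrapT => Hno.
have {Hno} unbounded (d M : R) : 0 < d -> 0 <= M ->
    exists t x, [/\ 0 < t, t <= d, D x & M * qn x < nrm (S t x)].
  move=> d0 M0; apply: contrapT => Hno2; apply: Hno.
  exists d, (M + 1); split => //; first by rewrite lerDr.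
  move=> t x t0 td Dx; rewrite leNgt; apply/negP => Htx.
  have M1x : M * qn x <= (M + 1) * qn x by rewrite ler_wpM2r // lerDl.
  have [t00|tN0] := eqVneq t 0.
    move: Htx; rewrite t00 (sg_0 SH) ltNge => /negP; apply.
    apply: le_trans (nrm_le_qn Dx) _.
    by rewrite -[leLHS]mul1r ler_wpM2r // lerDr.
  apply: Hno2; exists t, x; split => //; first by rewrite lt_neqAle eq_sym tN0.
  exact: le_lt_trans Htx.
(* Pairs are balls for [qn], given by radius and centre. The conditions put the ball r inside the
   ball c, and some time [t <= n.+1%:R^-1] gives every point of r an image of norm at least n. *)
pose good (n : nat) (c r : R * V) := [/\ 0 < r.1, r.1 <= c.1 / 2, D r.2,
  qn (r.2 - c.2) <= c.1 / 2 & exists t, [/\ 0 < t, t <= n.+1%:R^-1 &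
  forall z, D z -> qn (z - r.2) <= r.1 -> n%:R <= nrm (S t z)]].
have step n c : 0 < c.1 -> D c.2 -> exists r, good n c r.
  case: c => rho c /= rho0 Dc.
  have n1 : (0 : R) < n.+1%:R^-1 by rewrite invr_gt0.
  have [|t [x [t0 tn Dx Hx]]] := @unbounded _ (2 * n.+1%:R / rho) n1.
    by rewrite divr_ge0 ?mulr_ge0 ?ler0n // ltW.
  have St0 := ltW t0; have SL := sg_lin SH St0.
  have qx0 : 0 < qn x.
    rewrite lt_neqAle qn_ge0 andbT eq_sym; apply/eqP => qx0.
    have x0 : x = 0.
      apply: (nrm_eq0 HE); apply/eqP; rewrite eq_le nrm_ge0 andbT.
      by rewrite -qx0 nrm_le_qn.
    by move: Hx; rewrite qx0 x0 (lin0 SL) (nrm0 HE) mulr0 ltxx.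
  pose a : R := rho / 2 / qn x.
  have a0 : 0 < a by rewrite !divr_gt0.
  have Dv : D (a *: x) by exact: (psd_domZ EH).
  have qv : qn (a *: x) = rho / 2.
    by rewrite qnZ // gtr0_norm // /a divfK // gt_eqF.
  have Sv : n.+1%:R < nrm (S t (a *: x)).
    rewrite (linZ SL) (nrmZ HE) gtr0_norm //.
    move: Hx; rewrite -(ltr_pM2l a0); apply: le_lt_trans.
    rewrite le_eqVlt; apply/orP; left; apply/eqP; rewrite /a.
    move: (n.+1%:R : R) => w; field.
    by rewrite !gt_eqF.
  (* The images of [c + a *: x] and [c - a *: x] differ by more than [2 * n.+1%:R], so one of them
     has norm at least [n.+1%:R]. *)
  have [y [Dy qy Sy]] : exists y, [/\ D y, qn (y - c) <= rho / 2 &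
      n.+1%:R <= nrm (S t y)].
    have [le1|le1] := leP n.+1%:R (nrm (S t (c + a *: x))).
      exists (c + a *: x); split => //; first exact: (psd_domD EH).
      by rewrite addrC addKr qv.
    exists (c - a *: x); split => //; first exact: (psd_domB EH).
      by rewrite addrC addKr -scaleNr qnZ // normrN -qnZ // qv.
    have := nrmB HE (S t (c + a *: x)) (S t (c - a *: x)).
    have -> : S t (c + a *: x) - S t (c - a *: x) = 2 *: S t (a *: x).
      rewrite -(linB SL) -(linZ SL) opprB addrC addrA subrK.
      by rewrite scaler_nat mulr2n.
    rewrite (nrmZ HE) normr_nat.
    by move: Sv le1; move: (n.+1%:R : R) => w; lra.
  have [M M0 HM] := sg_bdd_pos St0.
  (* Within distance [M^-1] of [y] the image under [S t] moves by at most 1, which turns [n.+1] into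
     [n]. *)
  exists (Num.min (rho / 2) M^-1, y); split => //=.
  - by rewrite lt_min divr_gt0 // invr_gt0.
  - by rewrite ge_min lexx.
  exists t; split => // z Dz; rewrite le_min => /andP[_ zM].
  have Dzy := psd_domB EH Dz Dy.
  have := nrmD HE (S t z) (S t (y - z)); rewrite -(linD SL) subrKC.
  have : nrm (S t (y - z)) <= 1.
    apply: le_trans (HM _) _; rewrite -(divff (lt0r_neq0 M0)) ler_pM2l //.
    by rewrite (nrm_distC HE); apply: le_trans zM; exact: nrm_le_qn.
  by move: Sy; rewrite -natr1; move: (n%:R : R) => w; lra.
pose T := {c : R * V | 0 < c.1 /\ D c.2}.
have /choice [next nextP] (nc : nat * T) :
    exists r : T, good nc.1 (sval nc.2) (sval r).
  case: nc => n [c [c0 Dc]]; have [r Hr] := step n c c0 Dc.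
  by have [r0 _ Dr _ _] := Hr; exists (exist _ r (conj r0 Dr)).
pose c := fix c n : T := if n is m.+1 then next (m, c m)
  else exist _ (1, 0) (conj ltr01 (psd_dom0 EH)).
pose rho n : R := (sval (c n)).1; pose x n := (sval (c n)).2.
have cP n : good n (rho n, x n) (rho n.+1, x n.+1).
  by have := nextP (n, c n); rewrite /rho /x /=; case: (sval _); case: (sval _).
have Dx n : D (x n) by exact: (svalP (c n)).2.
have rho0 n : 0 < rho n by exact: (svalP (c n)).1.
have rhoS n : rho n.+1 <= rho n / 2 by case: (cP n).
have rho_le n : rho n <= n.+1%:R^-1.
  elim: n => [|n IH]; first by rewrite invr1 /rho.
  apply: le_trans (rhoS n) _; apply: (@le_trans _ _ (n.+1%:R^-1 / 2)).
    by rewrite ler_pM2r ?invr_gt0.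
  rewrite -invfM lef_pV2 ?posrE ?mulr_gt0 // -natrM ler_nat.
  by rewrite muln2 -addnn addSn addnS !ltnS leq_addr.
have dist n k : qn (x (k + n)%N - x n) <= rho n - rho (k + n)%N.
  elim: k => [|k IH].
    by rewrite add0n !subrr /qn (psd_0l qH) ?sqrtr0 //; exact: psd_dom0 EH.
  have := qnD (psd_domB EH (Dx (k + n).+1) (Dx (k + n)%N))
              (psd_domB EH (Dx (k + n)%N) (Dx n)).
  rewrite subrKA addSn; have [_ /= h1 _ h2 _] := cP (k + n)%N.
  by have := rho0 (k + n)%N; lra.
have dist_le n m : (n <= m)%N -> qn (x m - x n) <= rho n.
  move=> /subnK <-; apply: le_trans (dist _ _) _.
  by rewrite gerBl (ltW (rho0 _)).
have qnC u v : D u -> D v -> qn (u - v) = qn (v - u).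
  move=> Du Dv; rewrite -(opprB v u) -[- (v - u)]scaleN1r qnZ; last exact: (psd_domB EH).
  by rewrite normrN1 mul1r.
have [|z Dz xz] := hf_complete HE Dx.
  move=> e e0; have s0 : 0 < Num.sqrt e by rewrite sqrtr_gt0.
  have [N HN] := natSinv_lt (divr_gt0 s0 (ltr0n R 2)).
  exists N => m n Nm Nn; rewrite -(sqr_sqrtr (ltW e0)).
  apply: qn_lt => //; first exact: (psd_domB EH).
  have := qnD (psd_domB EH (Dx m) (Dx N)) (psd_domB EH (Dx N) (Dx n)).
  rewrite subrKA (qnC (x N)) //; have := dist_le _ _ Nm; have := dist_le _ _ Nn.
  by have := le_lt_trans (rho_le N) (HN _ (leqnn N)); lra.
have z_near n : qn (z - x n) <= rho n.
  apply: le_eps => e e0; have [N HN] := xz _ (exprn_gt0 2 e0).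
  pose m := maxn N n.
  have Nm : (N <= m)%N by exact: leq_maxl.
  have nm : (n <= m)%N by exact: leq_maxr.
  have := qnD (psd_domB EH Dz (Dx m)) (psd_domB EH (Dx m) (Dx n)).
  rewrite subrKA; have := dist_le _ _ nm.
  have : qn (z - x m) <= e.
    rewrite -ler_sqr ?nnegrE ?(ltW e0) // qnC // qn_sqr ?(ltW (HN _ Nm)) //.
    exact: (psd_domB EH).
  move: (qn _) (qn _) (qn _) (rho n) => a b d f; lra.
(* The common point [z] contradicts strong continuity at 0: for small t the norm of [S t z] stays
   below [nrm z + 1], whereas the nested balls provide small t at which it is at least any given
   n. *)
have [d d0 Hd] := sg_cont SH z ltr01.
have [N HN] := natSinv_lt d0.
pose n := maxn N (Num.truncn (nrm z + 1)).+1.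
have [_ _ _ _ [t [t0 tn /(_ z Dz (z_near n.+1)) Stz]]] := cP n.
have td : t < d by apply: le_lt_trans tn _; exact/HN/leq_maxl.
have := Hd t t0 td; have := nrmD HE (S t z - z) z; rewrite subrK.
have : nrm z + 1 < n%:R.
  by apply: lt_le_trans (truncnS_gt _) _; rewrite ler_nat leq_maxr.
by move: Stz; move: (n%:R : R) => w; lra.
Qed.

End semigroup.

(** * Contractivity and symmetry of the semigroup, by discretisation in time *)

Lemma telescope_le (R : realFieldType) (a : nat -> R) (c : R) n :
  (forall k, (k < n)%N -> a k.+1 <= a k + c) -> a n <= a 0%N + n%:R * c.
Proof.
elim: n => [|n IH] H; first by rewrite mul0r addr0.
apply: le_trans (H n (ltnSn n)) _; rewrite -natr1 mulrDl mul1r addrA lerD2r.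
by apply: IH => k kn; apply: H; exact: ltnW.
Qed.

Lemma subdivision (R : realType) (T d : R) : 0 < T -> 0 < d ->
  exists n : nat, [/\ (0 < n)%N, 0 < T / n%:R & T / n%:R < d].
Proof.
move=> T0 d0; exists (Num.truncn (T / d)).+1; split => //.
  by rewrite divr_gt0.
by rewrite ltr_pdivrMr // mulrC -ltr_pdivrMr // truncnS_gt.
Qed.

Section semigroup_theory.
Context {R : realType} {V : lmodType R}.
Variables (ip : V -> V -> R) (D : set V) (E : V -> V -> R).
Hypothesis HE : hilbert_form ip D E.

Let ipH := hf_ip HE.
Let EH := hf_form HE.
Notation nrm := (nrm ip).
Notation G := (form_operator ip D E).
Let nrm_ge0 := nrm_ge0 ip.

Variable S : R -> V -> V.
Hypothesis SH : semigroup_of ip D E S.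

(* Discretised form of d/ds |Q S_s x|^2 = - 2 (Q S_s x, Q S_s y) <= 0. *)
Lemma energy_decrease (Q : V -> V) x y (T K : R) : 0 <= T -> 0 <= K -> G x y ->
  lin Q -> (forall u w, G u w -> 0 <= ip (Q u) (Q w)) ->
  (forall s : R, 0 <= s -> s <= T -> nrm (Q (S s x)) <= K /\ nrm (Q (S s y)) <= K) ->
  (forall e : R, 0 < e -> exists2 d : R, 0 < d & forall h s : R, 0 < h -> h < d ->
     0 <= s -> s <= T -> nrm (Q (S s (S h x - x + h *: y))) <= h * e) ->
  ip (Q (S T x)) (Q (S T x)) <= ip (Q x) (Q x).
Proof.
move=> T0 K0 Gxy QL Qge0 bnd taylor.
have [->|TN0] := eqVneq T 0; first by rewrite (sg_0 SH).
have {T0 TN0} T0 : 0 < T by rewrite lt_neqAle eq_sym TN0.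
apply: le_eps => e e0.
pose B : R := T * (K ^+ 2 + 4 * K + 1).
have B0 : 0 < B by rewrite mulr_gt0 // ltr_wpDl // addr_ge0 ?sqr_ge0 ?mulr_ge0.
pose eta : R := Num.min 1 (e / B).
have eta0 : 0 < eta by rewrite lt_min ltr01 divr_gt0.
have eta1 : eta <= 1 by rewrite ge_min lexx.
have etaB : B * eta <= e by rewrite mulrC -ler_pdivlMr // ge_min lexx orbT.
have [d d0 Hd] := taylor _ eta0.
have [|n [n0 h0]] := @subdivision _ T (Num.min d eta) T0.
  by rewrite lt_min d0.
set h := T / n%:R in h0 *; rewrite lt_min => /andP[hd heta].
have hT : n%:R * h = T by rewrite mulrC divfK // pnatr_eq0 -lt0n.
pose a k : R := ip (Q (S (k%:R * h) x)) (Q (S (k%:R * h) x)).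
(* Expansion of the square of [Q (S s x) - h *: Q (S s y) + r]. The product of the first two terms
   has the good sign. In units of [h * eta], the square of the second term costs [K ^+ 2], the two
   products with [r] cost [4 * K], and the square of [r] costs 1. *)
have astep k : (k < n)%N -> a k.+1 <= a k + h * eta * (K ^+ 2 + 4 * K + 1).
  move=> kn; pose s := k%:R * h.
  have s0 : 0 <= s by rewrite mulr_ge0 // ltW.
  have sT : s <= T by rewrite -hT ler_wpM2r ?(ltW h0) // ler_nat ltnW.
  have [Kx Ky] := bnd _ s0 sT.
  have := Hd h s h0 hd s0 sT; set r := Q (S s _) => rh.
  have SL := sg_lin SH s0.
  have -> : a k.+1 = ip (Q (S s x) + (- h) *: Q (S s y) + r)
                        (Q (S s x) + (- h) *: Q (S s y) + r).
    rewrite /a -natr1 mulrDl mul1r (sg_D SH) ?(ltW h0) // -/s.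
    suff -> : Q (S s (S h x)) = Q (S s x) + (- h) *: Q (S s y) + r by [].
    rewrite /r (linD SL) (linB SL) (linZ SL) (linD QL) (linB QL) (linZ QL).
    by rewrite scaleNr [RHS]addrC addrACA subrK subrr addr0.
  have Gs := sg_op SH s0 Gxy; have := Qge0 _ _ Gs.
  rewrite (psd_expandD ipH) // (psd_expand ipH) // (ip_addl HE) (ip_scalel HE).
  rewrite /a -/s.
  have := le_trans (ler_norm _) (ip_le_nrm HE (Q (S s x)) r).
  have := le_trans (ler_norm _) (ip_le_nrm HE (- Q (S s y)) r).
  rewrite (nrmN HE) (ip_oppl HE) -(nrm_sqr HE r) -(nrm_sqr HE (Q (S s y))).
  move: (nrm_ge0 (Q (S s y))) (nrm_ge0 (Q (S s x))) (nrm_ge0 r).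
  move: (ip (Q (S s y)) r) (ip (Q (S s x)) r) (ip (Q (S s x)) (Q (S s y)))
    (ip (Q (S s x)) (Q (S s x))) Kx Ky rh => yr xr xy xx.
  move: (nrm (Q (S s x))) (nrm (Q (S s y))) (nrm r) => X Y Z XK YK Zh Y0 X0 Z0.
  move=> Hyr Hxr Hxy.
  have hh : h * h <= h * eta by rewrite ler_pM2l // ltW.
  have h1 : h <= 1 by lra.
  have he0 : 0 <= h * eta by rewrite mulr_ge0 // ltW.
  have p1 : X * Z <= K * (h * eta) by exact: ler_pM.
  have p2 : Y * Z <= K * (h * eta) by exact: ler_pM.
  have p3 : Y ^+ 2 <= K ^+ 2 by rewrite ler_sqr.
  have p4 : Z ^+ 2 <= h * eta.
    apply: (@le_trans _ _ ((h * eta) ^+ 2)).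
      by rewrite ler_sqr ?nnegrE // mulr_ge0 // ltW.
    by rewrite expr2 ler_piMr // mulr_ile1 // ltW.
  have p5 : h ^+ 2 * Y ^+ 2 <= h * eta * K ^+ 2.
    by apply: ler_pM => //; rewrite ?sqr_ge0 // expr2.
  have p6 : h * - yr <= K * (h * eta).
    have [yr0|yr0] := leP (- yr) 0.
      apply: (@le_trans _ _ 0); first by rewrite mulr_ge0_le0 // ltW.
      exact: mulr_ge0.
    apply: (@le_trans _ _ (- yr)); first by rewrite ler_piMl // ltW.
    exact: le_trans Hyr p2.
  have p7 : 0 <= h * xy by rewrite mulr_ge0 // ltW.
  have p8 : xr <= K * (h * eta) by exact: le_trans Hxr p1.
  rewrite sqrrN; lra.
have := telescope_le astep; rewrite /a hT mul0r (sg_0 SH) => /le_trans; apply.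
by rewrite lerD2l -(mulrA h) (mulrC eta) mulrA hT mulrA.
Qed.

(** [energy_decrease] with [Q = id] asks for bounds on the orbit and on the Taylor remainder.
    [sg_locally_bounded] gives them through the graph norm, for starting points in the domain of the
    squared operator and times up to [d]. Density then reaches all of V, and the semigroup law all
    times. *)
Lemma sg_contraction t x : 0 <= t -> nrm (S t x) <= nrm x.
Proof.
have [d [M [d0 M1 HM]]] := sg_locally_bounded HE SH.
have M0 : 0 < M by lra.
have D2 T u y z : 0 <= T -> T <= d -> G u y -> G y z ->
    nrm (S T u) <= nrm u.
  move=> T0 Td Gu Gy; pose q := graph_form ip E.
  pose K := Num.max (M * Num.sqrt (q u u)) (M * Num.sqrt (q y y)).
  rewrite -ler_sqr ?nnegrE // !(nrm_sqr HE).
  apply: (@energy_decrease id u y T K) => //.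
  - by rewrite le_max mulr_ge0 ?sqrtr_ge0 // ltW.
  - by move=> v w; exact: (op_ge0 HE).
  - move=> s s0 sT; rewrite !le_max !HM ?orbT //; try exact: le_trans sT Td.
    + exact: Gy.1.
    + exact: Gu.1.
  (* The remainder [w] and its image [w'] under the operator both have norm at most
     [h * e / (2 * M)], so the squared graph norm [ip w' w + ip w w] is at most
     [(h * e / M) ^+ 2]. *)
  move=> e e0; have e1 : 0 < e / (2 * M) by rewrite divr_gt0 // mulr_gt0.
  have [d1 d10 H1] := sg_taylor HE SH Gu e1.
  have [d2 d20 H2] := sg_taylor HE SH Gy e1.
  exists (Num.min d1 d2); first by rewrite lt_min d10.
  move=> h s h0; rewrite lt_min => /andP[hd1 hd2] s0 sT.
  set w := S h u - u + h *: y; set w' := S h y - y + h *: z.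
  have Gw : G w w'.
    apply: (op_add HE); last exact: (op_scale HE).
    by apply: (op_sub HE) => //; apply: (sg_op SH) => //; exact: ltW.
  apply: (le_trans (HM _ _ s0 (le_trans sT Td) Gw.1)).
  have he : h * e = M * Num.sqrt ((h * e / M) ^+ 2).
    rewrite sqrtr_sqr ger0_norm ?divr_ge0 ?mulr_ge0 ?(ltW h0) ?(ltW e0) ?(ltW M0) //.
    by rewrite [RHS]mulrC divfK // gt_eqF.
  rewrite he ler_pM2l // ler_wsqrtr //.
  rewrite /graph_form Gw.2 //; last exact: Gw.1.
  have := H1 h h0 hd1; have := H2 h h0 hd2; rewrite -/w -/w' => nw' nw.
  have -> : h * e / M = 2 * (h * (e / (2 * M))) by field; rewrite gt_eqF.
  have := le_trans (ler_norm _) (ip_le_nrm HE w' w).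
  rewrite -(nrm_sqr HE w).
  have := nrm_ge0 w; have := nrm_ge0 w'.
  move: (h * (e / (2 * M))) (nrm w) (nrm w') (ip w' w) nw nw' => a b c f; nra.
have small T u : 0 <= T -> T <= d -> nrm (S T u) <= nrm u.
  move=> T0 Td; have [N N0 HN] := sg_bdd_pos SH T0.
  apply: le_eps => e e0.
  have e1 : 0 < e / (N + 1) by rewrite divr_gt0 // addr_gt0.
  have [v [y [z [Gv Gy vu]]]] := op_dense2 HE u e1.
  have := D2 T v y z T0 Td Gv Gy.
  have := HN (u - v); rewrite (linB (sg_lin SH T0)).
  have := nrmD HE (S T u - S T v) (S T v); rewrite subrK.
  have := nrmD HE (v - u) u; rewrite subrK (nrm_distC HE u).
  have ee : (N + 1) * (e / (N + 1)) = e by rewrite mulrC divfK // gt_eqF ?addr_gt0.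
  move: vu (nrm_ge0 (v - u)).
  move: (nrm _) (nrm _) (nrm _) (nrm _) (nrm _) => a b c f g.
  nra.
move=> t0; have [->|tN0] := eqVneq t 0; first by rewrite (sg_0 SH).
have {t0 tN0} t0 : 0 < t by rewrite lt_neqAle eq_sym tN0.
have [n [n0 h0 hd]] := subdivision t0 d0.
have -> : t = n%:R * (t / n%:R) by rewrite mulrC divfK // pnatr_eq0 -lt0n.
elim: n {n0} (t / n%:R) h0 hd => [|n IH] h h0 hd; first by rewrite mul0r (sg_0 SH).
rewrite -natr1 mulrDl mul1r addrC (sg_D SH) ?(ltW h0) //.
  by apply: le_trans (small _ _ _ _) (IH _ h0 hd); exact: ltW.
by rewrite mulr_ge0 // ltW.
Qed.

(** The derivative of [ip (S (T - s) u) (S s v)] in s vanishes because the operator is symmetric, so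
    its increments over short steps are negligible and telescope. One inequality on the domain of
    the operator suffices, exchanging u and v gives the other, and density concludes. *)
Lemma sg_sym t x y : 0 <= t -> ip (S t x) y = ip x (S t y).
Proof.
have op_case T u u' v v' : 0 <= T -> G u u' -> G v v' ->
    ip (S T u) v <= ip u (S T v).
  move=> T0 Gu Gv.
  have [->|TN0] := eqVneq T 0; first by rewrite !(sg_0 SH).
  have {T0 TN0} T0 : 0 < T by rewrite lt_neqAle eq_sym TN0.
  rewrite -lerN2; apply: le_eps => e e0.
  pose B : R := T * (nrm u + nrm v + 1).
  have B0 : 0 < B by rewrite mulr_gt0 // ltr_wpDl // addr_ge0.
  have e1 : 0 < e / B by rewrite divr_gt0.
  have [d1 d10 H1] := sg_taylor HE SH Gu e1.
  have [d2 d20 H2] := sg_taylor HE SH Gv e1.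
  have [|n [n0 h0]] := @subdivision _ T (Num.min d1 d2) T0.
    by rewrite lt_min d10.
  set h := T / n%:R in h0 *; rewrite lt_min => /andP[hd1 hd2].
  have hT : n%:R * h = T by rewrite mulrC divfK // pnatr_eq0 -lt0n.
  have hk0 k : 0 <= k%:R * h by rewrite mulr_ge0 // ltW.
  pose a k : R := - ip (S ((n - k)%:R * h) u) (S (k%:R * h) v).
  have astep k : (k < n)%N -> a k.+1 <= a k + h * (e / B) * (nrm u + nrm v).
    move=> kn; rewrite /a -[(n - k)%N]subnSK // -!natr1 !mulrDl !mul1r.
    rewrite !(sg_D SH) ?(ltW h0) //; set s := (n - k.+1)%:R * h; set r := k%:R * h.
    have sL := sg_lin SH (hk0 (n - k.+1)%N); have rL := sg_lin SH (hk0 k).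
    rewrite -/s -/r in sL rL.
    have := H1 h h0 hd1; have := H2 h h0 hd2.
    set zv := S h v - v + _; set zu := S h u - u + _ => nv nu.
    have -> : S h v = v - h *: v' + zv by rewrite [RHS]addrC addrACA subrK subrr addr0.
    have -> : S h u = u - h *: u' + zu by rewrite [RHS]addrC addrACA subrK subrr addr0.
    rewrite (linD sL) (linB sL) (linZ sL) (linD rL) (linB rL) (linZ rL).
    rewrite !(ip_addl HE, ip_addr HE, ip_oppl HE, ip_oppr HE, ip_scalel HE, ip_scaler HE).
    have := op_sym HE (sg_op SH (hk0 (n - k.+1)%N) Gu) (sg_op SH (hk0 k) Gv).
    rewrite -/s -/r => ->.
    have p1 : - ip (S s u) (S r zv) <= nrm u * (h * (e / B)).
      apply: le_trans (ler_norm _) _; rewrite normrN.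
      apply: le_trans (ip_le_nrm HE _ _) _; apply: ler_pM => //.
        exact/sg_contraction/hk0.
      by apply: le_trans nv; exact/sg_contraction/hk0.
    have p2 : ip (S s zu) (S r v) <= nrm v * (h * (e / B)).
      apply: le_trans (ler_norm _) _.
      apply: le_trans (ip_le_nrm HE _ _) _; rewrite mulrC; apply: ler_pM => //.
        exact/sg_contraction/hk0.
      by apply: le_trans nu; exact/sg_contraction/hk0.
    by lra.
  have := telescope_le astep; rewrite /a subnn subn0 hT mul0r !(sg_0 SH).
  move=> /le_trans; apply; rewrite lerD2l mulrA mulrA hT.
  have -> : T * (e / B) * (nrm u + nrm v) = e / B * (T * (nrm u + nrm v)) by ring.
  by rewrite -ler_pdivlMl // invf_div divfK ?gt_eqF // /B; nra.
have op_eq T u u' v v' : 0 <= T -> G u u' -> G v v' ->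
    ip (S T u) v = ip u (S T v).
  move=> T0 Gu Gv; apply/eqP; rewrite eq_le (op_case _ _ _ _ _ T0 Gu Gv).
  by rewrite (ip_sym HE u) (ip_sym HE _ v) (op_case _ _ _ _ _ T0 Gv Gu).
move=> t0; have SL := sg_lin SH t0.
suff defect w (e : R) : 0 < e -> exists2 w' : V, nrm (w - w') < e & exists v, G w' v.
  apply/eqP; rewrite -subr_eq0 -normr_eq0; apply/eqP; apply: eq0_eps => // e e0.
  (* The defect of symmetry at a pair (a, b) is at most [2 * (nrm a * nrm b)]. It is bounded at
     [(x - u, y)] and [(u, y - v)], where [nrm u <= nrm x + 1]. *)
  pose k : R := 2 * (nrm x + nrm y + 1) + 1.
  have k0 : 0 < k by rewrite ltr_wpDl // mulr_ge0 // !addr_ge0.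
  have e1 : 0 < Num.min 1 (e / k) by rewrite lt_min ltr01 divr_gt0.
  have [u ux [u' Gu]] := defect x _ e1.
  have [v vy [v' Gv]] := defect y _ e1.
  have -> : ip (S t x) y - ip x (S t y) =
      ip (S t (x - u)) y - ip (x - u) (S t y)
      + (ip (S t u) (y - v) - ip u (S t (y - v))).
    rewrite !(linB SL) !(ip_subl HE) !(ip_subr HE) (op_eq _ _ _ _ _ t0 Gu Gv).
    ring.
  have ineq a b : `|ip (S t a) b - ip a (S t b)| <= 2 * (nrm a * nrm b).
    apply: le_trans (ler_normB _ _) _.
    have := ip_le_nrm HE (S t a) b; have := ip_le_nrm HE a (S t b).
    have := ler_wpM2r (nrm_ge0 b) (sg_contraction a t0).
    have := ler_wpM2l (nrm_ge0 a) (sg_contraction b t0).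
    by lra.
  apply: le_trans (ler_normD _ _) _.
  apply: le_trans (lerD (ineq _ _) (ineq _ _)) _.
  move: ux vy; rewrite !lt_min => /andP[ux1 uxe] /andP[vy1 vye].
  have := nrmD HE (u - x) x; rewrite subrK (nrm_distC HE u) => nu.
  have ek : e / k * k = e by rewrite divfK // gt_eqF.
  have p1 : nrm (x - u) * nrm y <= e / k * nrm y by rewrite ler_wpM2r // ltW.
  have p2 : nrm u * nrm (y - v) <= (nrm x + 1) * (e / k).
    by apply: ler_pM => //; [lra | exact: ltW].
  by rewrite -[leRHS]ek /k; move: (divr_gt0 e0 k0); lra.
move=> e0; have [u [v [Gu uw]]] := op_dense HE w e0.
by exists u; [rewrite (nrm_distC HE) | exists v].
Qed.

End semigroup_theory.

(** * Orthogonal projections, the semigroup and the form domain *)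

Section invariance.
Context {R : realType} {V : lmodType R}.
Variables (ip : V -> V -> R) (D : set V) (E : V -> V -> R).
Hypothesis HE : hilbert_form ip D E.

Let ipH := hf_ip HE.
Let EH := hf_form HE.
Notation nrm := (nrm ip).
Notation G := (form_operator ip D E).
Let nrm_ge0 := nrm_ge0 ip.

Variable S : R -> V -> V.
Hypothesis SH : semigroup_of ip D E S.

Lemma sg_halves t x : 0 < t -> S t x = S (t / 2) (S (t / 2) x).
Proof. by move=> t0; rewrite -(sg_D SH) -?splitr // divr_ge0 // ltW. Qed.

Lemma sg_psd t : 0 < t -> contractive_psd ip (S t).
Proof.
move=> t0; have t2 : 0 <= t / 2 by rewrite divr_ge0 // ltW.
have St x : ip (S t x) x = ip (S (t / 2) x) (S (t / 2) x).
  by rewrite sg_halves // (sg_sym HE SH).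
split => [|x y|x|x].
- exact/(sg_lin SH)/ltW.
- exact/(sg_sym HE SH)/ltW.
- by rewrite St (ip_ge0 HE).
- by rewrite St -!(nrm_sqr HE) ler_sqr ?nnegrE // (sg_contraction HE SH).
Qed.

Lemma halving_lt (t d : R) : 0 < t -> 0 < d -> exists n, t / 2 ^+ n < d.
Proof.
move=> t0 d0; exists (Num.truncn (t / d)).+1.
rewrite ltr_pdivrMr ?exprn_gt0 // mulrC -ltr_pdivrMr //.
apply: lt_le_trans (truncnS_gt _) _.
by rewrite -natrX ler_nat ltnW // ltn_expl.
Qed.

(** By symmetry [ip (S (t / 2) x) (S (t / 2) x) = ip (S t x) x = 0]. Repeated halving annihilates
    [x] at arbitrarily small times, and strong continuity concludes. *)
Lemma sg_inj t x : 0 < t -> S t x = 0 -> x = 0.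
Proof.
move=> t0 Stx.
have Sn n : S (t / 2 ^+ n) x = 0.
  elim: n => [|n IH]; first by rewrite expr0 divr1.
  have h0 : 0 < t / 2 ^+ n by rewrite divr_gt0 // exprn_gt0.
  have h2 : 0 <= t / 2 ^+ n / 2 by rewrite divr_ge0 // ltW.
  rewrite exprSr invfM mulrA; apply: (hf_def HE).
  by rewrite -(sg_sym HE SH) // -sg_halves // IH (ip_0l HE).
apply: (nrm_eps0 HE) => e e0; have [d d0 Hd] := sg_cont SH x e0.
have [n tn] := halving_lt t0 d0.
have := Hd _ _ tn; rewrite Sn sub0r (nrmN HE) => H; apply/ltW/H.
by rewrite divr_gt0 // exprn_gt0.
Qed.

Variable P : V -> V.
Hypotheses (PL : lin P) (Psym : forall x y, ip (P x) y = ip x (P y))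
  (PP : forall x, P (P x) = P x).

Lemma proj_contraction x : nrm (P x) <= nrm x.
Proof.
have [->|Px0] := eqVneq (nrm (P x)) 0; first exact: nrm_ge0.
have {}Px0 : 0 < nrm (P x) by rewrite lt_neqAle eq_sym Px0 nrm_ge0.
rewrite -(ler_pM2r Px0) -expr2 (nrm_sqr HE) Psym PP.
by apply: le_trans (ler_norm _) _; exact: (ip_le_nrm HE).
Qed.

(** At time [t] invariance reads [P S P = S P], and its adjoint [P S P = P S]. Each halving is an
    instance of [commute_square_root], for [S (h / 2)] with square [S h]. *)
Lemma proj_commute_sg t : 0 < t -> (forall x, P (S t (P x)) = S t (P x)) ->
  forall n x, S (t / 2 ^+ n) (P x) = P (S (t / 2 ^+ n) x).
Proof.
move=> t0 inv; elim => [|n IH] x.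
  rewrite expr0 divr1; apply: (ip_ext HE) => z.
  have St := sg_sym HE SH _ _ (ltW t0).
  by rewrite (Psym (S t x)) (St x) -(inv z) -Psym -St -Psym inv.
have h0 : 0 < t / 2 ^+ n by rewrite divr_gt0 // exprn_gt0.
have h2 : 0 < t / 2 ^+ n / 2 by rewrite divr_gt0.
rewrite exprSr invfM mulrA.
apply: (commute_square_root HE (sg_psd h2)) => // [y|y].
  exact: sg_inj.
by rewrite -!sg_halves.
Qed.

(* P f is in the domain of the adjoint of the operator, which is self-adjoint
   because 1 + H is onto. *)
Lemma proj_commute_op t x y : 0 < t -> (forall x, P (S t (P x)) = S t (P x)) ->
  G x y -> G (P x) (P y).
Proof.
move=> t0 inv Gxy.
(* [P] is known to commute with the semigroup only at the times [t / 2 ^+ n]; they tend to 0, which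
   suffices to compare difference quotients. *)
have weak v w : G v w -> ip (P x) w = ip (P y) v.
  move=> Gvw; apply/eqP; rewrite -subr_eq0 -normr_eq0; apply/eqP.
  apply: eq0_eps => // e e0.
  pose k := nrm x + nrm v + 1.
  have k0 : 0 < k by rewrite ltr_wpDl // addr_ge0.
  have e1 : 0 < e / k by rewrite divr_gt0.
  have [d1 d10 H1] := (sg_gen SH x y).1 Gxy _ e1.
  have [d2 d20 H2] := (sg_gen SH v w).1 Gvw _ e1.
  have [|n] := @halving_lt t (Num.min d1 d2) t0; first by rewrite lt_min d10.
  have := proj_commute_sg t0 inv n.
  have : 0 < t / 2 ^+ n by rewrite divr_gt0 // exprn_gt0.
  move: (t / 2 ^+ n) => h h0 Ph; rewrite lt_min => /andP[hd1 hd2].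
  have n1 := H1 h h0 hd1; have n2 := H2 h h0 hd2.
  have -> : ip (P x) w - ip (P y) v =
      ip (P (h^-1 *: (x - S h x) - y)) v - ip (P x) (h^-1 *: (v - S h v) - w).
    rewrite !(linB PL, linZ PL) !(ip_subl HE, ip_subr HE, ip_scalel HE, ip_scaler HE).
    by rewrite -Ph (sg_sym HE SH) ?(ltW h0) //; ring.
  apply: le_trans (ler_normB _ _) _.
  apply: le_trans (lerD (ip_le_nrm HE _ _) (ip_le_nrm HE _ _)) _.
  have p1 := proj_contraction x.
  have := proj_contraction (h^-1 *: (x - S h x) - y).
  have ek : e / k * k = e by rewrite divfK // gt_eqF.
  move: n1 n2 ek p1 e1; rewrite /k.
  move: (nrm_ge0 (P x)) (nrm_ge0 v) (nrm_ge0 x).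
  move: (nrm_ge0 (P (h^-1 *: (x - S h x) - y))) (nrm_ge0 (h^-1 *: (v - S h v) - w)).
  move: (nrm (P (h^-1 *: (x - S h x) - y))) (nrm (h^-1 *: (x - S h x) - y)).
  move: (nrm (h^-1 *: (v - S h v) - w)) (nrm (P x)) (nrm x) (nrm v) (e / _).
  move=> a b c f g i j i0 a0 b0 f0 c0 jg ag egk bc g0 ij.
  have : i * f <= g * f by rewrite ler_wpM2r //; lra.
  have : b * a <= c * g by apply: ler_pM => //; lra.
  lra.
(* With [u + u' = P x + P y], [weak] gives [P x] and [u] the same inner product with every [v + w]
   such that [G v w], that is with every vector. *)
have [u [u' [Gu uu' _]]] := op_resolvent HE (P x + P y) ltr01.
rewrite scale1r in uu'.
suff uP : u = P x.
  by rewrite -uP; have -> : P y = u' by apply: (addrI (P x)); rewrite -uu' uP.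
apply: (ip_ext HE) => z.
have [v [w [Gv <- _]]] := op_resolvent HE z ltr01.
rewrite scale1r !(ip_addr HE) (weak _ _ Gv) -(op_sym HE Gu Gv).
by rewrite -!(ip_addl HE) uu'.
Qed.

Theorem form_dom_invariant t : 0 < t -> (forall x, P (S t (P x)) = S t (P x)) ->
  forall f, D f -> D (P f).
Proof.
move=> t0 inv f Df; apply: (form_lsc HE (C := E f f)) => e e0.
have s0 : 0 < Num.sqrt e by rewrite sqrtr_gt0.
have [u [y [Gu Eu uf]]] := op_dense_form HE Df s0.
have GP := proj_commute_op t0 inv Gu.
have GQ := op_sub HE Gu GP.
exists (P u); first exact: GP.1.
split.
  apply: le_trans Eu; rewrite GP.2; last exact: GP.1.
  rewrite Gu.2; last exact: Gu.1.
  (* Positivity of the operator at [u - P u], where the mixed terms reduce to [ip (P u) (P y)]. *)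
  have := op_ge0 HE GQ; rewrite !(ip_subl HE) !(ip_subr HE) (ip_sym HE u y).
  rewrite (ip_sym HE (P u) y) (ip_sym HE u (P y)) (ip_sym HE (P u) (P y)).
  by rewrite !Psym !PP; lra.
rewrite -(linB PL) -(nrm_sqr HE) -(sqr_sqrtr (ltW e0)).
rewrite ler_sqr ?nnegrE ?sqrtr_ge0 //.
by apply: le_trans (proj_contraction _) _; exact: ltW.
Qed.

(** Orthogonality makes [P] symmetric for [E], whence it maps the graph of the operator to itself.
    So does [Q = 1 - P], which is the positivity that [energy_decrease] asks of [Q]. *)
Theorem semigroup_invariant : (forall f, D f -> D (P f)) ->
  (forall f g, D f -> D g -> E (P f) (g - P g) = 0) ->
  forall t x, 0 <= t -> P x = x -> P (S t x) = S t x.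
Proof.
move=> DP Eorth t x t0 Px.
have EP f g : D f -> D g -> E (P f) g = E f (P g).
  move=> Df Dg; have := Eorth _ _ Df Dg; have := Eorth _ _ Dg Df.
  have := DP _ Df; have := DP _ Dg => DPg DPf.
  rewrite !(psd_subr EH) //; rewrite (psd_sym EH DPg DPf) (psd_sym EH DPg Df).
  by move=> /eqP; rewrite subr_eq0 => /eqP -> /eqP; rewrite subr_eq0 => /eqP ->.
have GP u w : G u w -> G (P u) (P w).
  move=> [Du Hu]; split; first exact: DP.
  by move=> h Dh; rewrite EP // Hu; [rewrite Psym | exact: DP].
pose Q u := u - P u.
have QL : lin Q.
  by move=> a u v; rewrite /Q PL scalerBr opprD addrACA.
have Qnrm u : nrm (Q u) <= nrm u.
  rewrite -ler_sqr ?nnegrE // !(nrm_sqr HE) /Q (psd_expandB ipH) //.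
  have PPu : ip (P u) (P u) = ip u (P u) by rewrite Psym PP.
  by have := ip_ge0 HE (P u); rewrite PPu; lra.
have invG u w : G u w -> Q u = 0 -> Q (S t u) = 0.
  move=> Gu Qu; apply: (hf_def HE); apply/eqP.
  rewrite eq_le (ip_ge0 HE) andbT.
  have -> : 0 = ip (Q u) (Q u) by rewrite Qu (ip_0l HE).
  apply: (@energy_decrease _ _ _ _ _ HE _ SH Q u w t (Num.max (nrm u) (nrm w))) => //.
  - by rewrite le_max nrm_ge0.
  - by move=> v v' Gv; apply: (op_ge0 HE (op_sub HE Gv (GP _ _ Gv))).
  - move=> s s0 _; rewrite !le_max; split; apply/orP; [left|right];
    by apply: le_trans (Qnrm _) _; exact: (sg_contraction HE SH).
  move=> e e0; have [d d0 Hd] := sg_taylor HE SH Gu e0; exists d => // h s h0 hd s0 _.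
  apply: le_trans (Qnrm _) _; apply: le_trans (sg_contraction HE SH _ s0) _.
  exact: Hd.
suff : Q (S t x) = 0 by move/eqP; rewrite subr_eq0 => /eqP.
apply: (nrm_eps0 HE) => e e0.
have [u [w [Gu ux]]] := op_dense HE x e0.
(* [x = P x] is approximated by [P u] rather than [u], so that the approximant is itself fixed by
   [P]. *)
have -> : Q (S t x) = Q (S t (P (x - u))) + Q (S t (P u)).
  by rewrite -(linD QL) -(linD (sg_lin SH t0)) -(linD PL) subrK Px.
rewrite (invG _ _ (GP _ _ Gu)) ?addr0; last by rewrite /Q PP subrr.
apply: le_trans (Qnrm _) _; apply: le_trans (sg_contraction HE SH _ t0) _.
apply: le_trans (proj_contraction _) _.
by rewrite (nrm_distC HE) ltW.
Qed.

End invariance.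

Local Open Scope complex_scope.

(** * Square-integrable complex functions *)

Section complex_parts.
Context {R : realType}.
Implicit Types z w : R[i].

Lemma Re_add z w : complex.Re (z + w) = complex.Re z + complex.Re w.
Proof. by case: z => a b; case: w. Qed.
Lemma Im_add z w : complex.Im (z + w) = complex.Im z + complex.Im w.
Proof. by case: z => a b; case: w. Qed.
Lemma Re_mul z w :
  complex.Re (z * w) = complex.Re z * complex.Re w - complex.Im z * complex.Im w.
Proof. by case: z => a b; case: w. Qed.
Lemma Im_mul z w :
  complex.Im (z * w) = complex.Re z * complex.Im w + complex.Im z * complex.Re w.
Proof. by case: z => a b; case: w. Qed.
Lemma Re_conjc z : complex.Re z^* = complex.Re z.
Proof. by case: z. Qed.
Lemma Im_conjc z : complex.Im z^* = - complex.Im z.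
Proof. by case: z. Qed.
Lemma complex_eq z w :
  complex.Re z = complex.Re w -> complex.Im z = complex.Im w -> z = w.
Proof. by case: z => a b; case: w => c d /= -> ->. Qed.
Lemma normc_sqrtE z :
  ComplexField.Normc.normc z = Num.sqrt (complex.Re z ^+ 2 + complex.Im z ^+ 2).
Proof. by case: z. Qed.
End complex_parts.

Section L2_functions.
Context {d : measure_display} {T : measurableType d} {R : realType}.
Variable mu : {measure set T -> \bar R}.
Implicit Types f g h : T -> R[i].

Definition re_dot f g x : R :=
  complex.Re (f x) * complex.Re (g x) + complex.Im (f x) * complex.Im (g x).

Definition re_ip f g : R := complex.Re (L2dot mu f g).

Lemma re_ipE f g : re_ip f g = \int[mu]_x re_dot f g x.
Proof.
rewrite /re_ip /=; apply: eq_Rintegral => x _.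
by rewrite Re_mul Re_conjc Im_conjc /re_dot; ring.
Qed.

Lemma re_dot_ge0 f x : 0 <= re_dot f f x.
Proof. by rewrite addr_ge0 // -expr2 sqr_ge0. Qed.

Lemma cmeasurable_lin (c : R[i]) f g : cmeasurable f -> cmeasurable g ->
  cmeasurable (cst c \* f \+ g).
Proof.
move=> [rf if_] [rg ig]; split.
- rewrite (_ : (fun _ => _) = (fun x => complex.Re c * complex.Re (f x)
    - complex.Im c * complex.Im (f x) + complex.Re (g x))).
    by apply: measurable_funD => //; apply: measurable_funB; exact: measurable_funM.
  by apply/funext => x /=; rewrite Re_add Re_mul.
- rewrite (_ : (fun _ => _) = (fun x => complex.Re c * complex.Im (f x)
    + complex.Im c * complex.Re (f x) + complex.Im (g x))).
    by apply: measurable_funD => //; apply: measurable_funD; exact: measurable_funM.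
  by apply/funext => x /=; rewrite Im_add Im_mul.
Qed.

Lemma measurable_re_dot f g : cmeasurable f -> cmeasurable g ->
  measurable_fun setT (re_dot f g).
Proof.
by move=> [rf if_] [rg ig]; apply: measurable_funD; exact: measurable_funM.
Qed.

Lemma cLnorm2_pow f :
  (cLnorm mu 2%:E f = (\int[mu]_x (re_dot f f x)%:E) `^ 2^-1)%E.
Proof.
rewrite /cLnorm unlock; congr (_ `^ _)%E; apply: eq_integral => x _ /=.
rewrite normc_sqrtE ger0_norm ?sqrtr_ge0 // powR_mulrn ?sqrtr_ge0 //.
by rewrite sqr_sqrtr ?addr_ge0 ?sqr_ge0.
Qed.

Lemma L2P f : L2 mu f <-> cmeasurable f /\ mu.-integrable setT (EFin \o re_dot f f).
Proof.
have abs_re x : `|(re_dot f f x)%:E|%E = (re_dot f f x)%:E.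
  by rewrite /= ger0_norm // re_dot_ge0.
split => [[mf fi]|[mf /integrableP[_ fi]]]; last first.
  split => //; rewrite cLnorm2_pow poweR_lty //.
  by under eq_integral do rewrite -abs_re.
split => //; apply/integrableP; split.
  by apply/measurable_EFinP; exact: measurable_re_dot.
under eq_integral do rewrite /comp abs_re.
have := poweR_lty 2 fi; rewrite cLnorm2_pow -poweRrM mulVf // poweRe1 //.
by apply: integral_ge0 => x _; rewrite lee_fin re_dot_ge0.
Qed.

Lemma cLnorm2E f : L2 mu f -> cLnorm mu 2%:E f = (Num.sqrt (re_ip f f))%:E.
Proof.
move=> /L2P[mf fi]; rewrite cLnorm2_pow re_ipE /Rintegral.
set I := (\int[mu]_x (re_dot f f x)%:E)%E.
have If : I \is a fin_num by exact: integrable_fin_num fi.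
have I0 : (0 <= I)%E by apply: integral_ge0 => x _; rewrite lee_fin re_dot_ge0.
by rewrite -[in LHS](fineK If) poweR_EFin powR12_sqrt // fine_ge0.
Qed.

Lemma integrable_re_dot f g : L2 mu f -> L2 mu g ->
  mu.-integrable setT (EFin \o re_dot f g).
Proof.
move=> /L2P[mf fi] /L2P[mg gi].
apply: le_integrable (integrableD measurableT fi gi) => //.
  by apply/measurable_EFinP; exact: measurable_re_dot.
move=> x _ /=; rewrite lee_fin [leRHS]ger0_norm; last first.
  by rewrite addr_ge0 ?re_dot_ge0.
rewrite ler_norml /re_dot; apply/andP.
move: (complex.Re (f x)) (complex.Im (f x)) (complex.Re (g x)) (complex.Im (g x)).
move=> a b c e; have := sqr_ge0 (a - c); have := sqr_ge0 (b - e).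
by have := sqr_ge0 (a + c); have := sqr_ge0 (b + e); split; nra.
Qed.

Lemma L2_lin (c : R[i]) f g : L2 mu f -> L2 mu g -> L2 mu (cst c \* f \+ g).
Proof.
move=> Lf Lg; have := integrable_re_dot Lf Lf; have := integrable_re_dot Lg Lg.
have [mf _] := Lf; have [mg _] := Lg; move=> ig if_.
have mh := cmeasurable_lin c mf mg.
apply/L2P; split => //.
pose k := complex.Re c ^+ 2 + complex.Im c ^+ 2.
(* The constant comes from [|c f + g|^2 <= 2 |c|^2 |f|^2 + 2 |g|^2], with [k = |c|^2]. *)
have := integrableZl measurableT (2 * k + 2) (integrableD measurableT if_ ig).
apply: le_integrable => //.
  by apply/measurable_EFinP; exact: measurable_re_dot.
move=> x _ /=; rewrite lee_fin !ger0_norm ?re_dot_ge0 //; last first.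
  apply: mulr_ge0; last by rewrite addr_ge0 ?re_dot_ge0.
  by rewrite addr_ge0 // mulr_ge0 // addr_ge0 ?sqr_ge0.
rewrite /re_dot /= !Re_add !Im_add !Re_mul !Im_mul /k.
move: (complex.Re (f x)) (complex.Im (f x)) (complex.Re (g x)) (complex.Im (g x)).
move: (complex.Re c) (complex.Im c) => u v a b p q.
have := sqr_ge0 (u * a - v * b - p); have := sqr_ge0 (u * b + v * a - q).
have : 0 <= (u ^+ 2 + v ^+ 2) * (p ^+ 2 + q ^+ 2).
  by rewrite mulr_ge0 ?addr_ge0 ?sqr_ge0.
have := sqr_ge0 a; have := sqr_ge0 b; have := sqr_ge0 p; have := sqr_ge0 q.
lra.
Qed.

Lemma L2_0 : L2 mu (cst 0).
Proof.
apply/L2P; split; first by split; exact: measurable_cst.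
rewrite (_ : _ \o _ = cst 0%E); first exact: integrable0.
by apply/funext => x; rewrite /= /re_dot /= mul0r addr0.
Qed.

Lemma L2D f g : L2 mu f -> L2 mu g -> L2 mu (f \+ g).
Proof.
move=> Lf Lg; rewrite (_ : _ \+ _ = cst 1 \* f \+ g); first exact: L2_lin.
by apply/funext => x /=; rewrite mul1r.
Qed.

Lemma L2Z (c : R[i]) f : L2 mu f -> L2 mu (cst c \* f).
Proof.
move=> Lf; rewrite (_ : cst c \* f = cst c \* f \+ cst 0).
  exact: L2_lin Lf L2_0.
by apply/funext => x /=; rewrite addr0.
Qed.

Lemma L2B f g : L2 mu f -> L2 mu g -> L2 mu (f \- g).
Proof.
move=> Lf Lg; rewrite (_ : _ \- _ = cst (-1) \* g \+ f); first exact: L2_lin.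
by apply/funext => x /=; rewrite mulN1r addrC.
Qed.

Lemma re_ipC f g : re_ip f g = re_ip g f.
Proof.
rewrite !re_ipE; apply: eq_Rintegral => x _; rewrite /re_dot.
by rewrite mulrC [X in _ + X]mulrC.
Qed.

Lemma re_ip_lin (a : R) f g h : L2 mu f -> L2 mu g -> L2 mu h ->
  re_ip (cst a%:C \* f \+ g) h = a * re_ip f h + re_ip g h.
Proof.
move=> Lf Lg Lh; rewrite !re_ipE -RintegralZl //; last exact: integrable_re_dot.
rewrite -RintegralD //.
- apply: eq_Rintegral => x _; rewrite /re_dot /= Re_add Im_add Re_mul Im_mul /=.
  by ring.
- have := integrableZl measurableT a (integrable_re_dot Lf Lh).
  by apply: eq_integrable.
- exact: integrable_re_dot.
Qed.

Lemma re_ip_ge0 f : 0 <= re_ip f f.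
Proof. by rewrite re_ipE; apply: Rintegral_ge0 => x _; exact: re_dot_ge0. Qed.

Lemma re_ip_eq0 f : L2 mu f -> re_ip f f = 0 -> f = cst 0 %[ae mu].
Proof.
move=> Lf; rewrite re_ipE /Rintegral => fi.
have ff := integrable_re_dot Lf Lf.
have : (\int[mu]_x `|(re_dot f f x)%:E| = 0)%E.
  have := fineK (integrable_fin_num measurableT ff); rewrite [X in X%:E]fi => /esym I0.
  apply: etrans I0.
  by apply: eq_integral => x _; rewrite /= ger0_norm // re_dot_ge0.
have mff : measurable_fun setT (EFin \o re_dot f f) by exact: measurable_int ff.
move=> /(ae_eq_integral_abs mu measurableT mff); apply: filterS => x H _.
have /eqP := H I; rewrite /= eqe /re_dot -!expr2 paddr_eq0 ?sqr_ge0 //.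
rewrite !sqrf_eq0 => /andP[/eqP fr /eqP fim].
by apply: complex_eq; rewrite ?fr ?fim.
Qed.

Lemma re_ip_ae f f' g : L2 mu f -> L2 mu f' -> L2 mu g -> f = f' %[ae mu] ->
  re_ip f g = re_ip f' g.
Proof.
move=> Lf Lf' Lg ff'; rewrite !re_ipE /Rintegral; congr fine.
have m u : L2 mu u -> measurable_fun setT (EFin \o re_dot u g).
  by move=> Lu; exact: measurable_int (integrable_re_dot Lu Lg).
apply: ae_eq_integral => //; [exact: m|exact: m|].
by move: ff'; apply: filterS => x fx _; rewrite /re_dot /= fx.
Qed.

End L2_functions.

(** * The real inner product space of classes of square-integrable functions *)

Section L2_quotient.
Context {d : measure_display} {T : measurableType d} {R : realType}.
Variable mu : {measure set T -> \bar R}.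
Implicit Types f g h : T -> R[i].

Lemma ae_sym (U : Type) (u v : T -> U) : u = v %[ae mu] -> v = u %[ae mu].
Proof. by apply: filterS => x uv _; rewrite uv. Qed.

Lemma ae_trans (U : Type) (u v w : T -> U) :
  u = v %[ae mu] -> v = w %[ae mu] -> u = w %[ae mu].
Proof. by apply: filterS2 => x uv vw _; rewrite uv // vw. Qed.

Definition L2rep f := xget (cst 0) [set g | L2 mu g /\ f = g %[ae mu]].

Lemma L2repP f : L2 mu f -> L2 mu (L2rep f) /\ f = L2rep f %[ae mu].
Proof.
move=> Lf; rewrite /L2rep; case: xgetP => [g _ //|/(_ f)[]].
by split => //; exact: aeW.
Qed.

Lemma L2rep_ae f g : f = g %[ae mu] -> L2rep f = L2rep g.
Proof.
move=> fg; congr (xget _ _); apply/seteqP; split => h [Lh eh]; split => //.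
  exact: ae_trans (ae_sym fg) eh.
exact: ae_trans fg eh.
Qed.

(* The Hilbert space of square-integrable functions modulo null functions;
   each class is represented by its image under the choice function L2rep. *)
Record L2space := MkL2space {
  L2fun :> T -> R[i] ;
  L2funP : L2 mu L2fun /\ L2rep L2fun = L2fun }.

Lemma L2space_eq (x y : L2space) : L2fun x = L2fun y -> x = y.
Proof.
case: x => f Pf; case: y => g Pg /= fg; rewrite fg in Pf *.
by rewrite (Prop_irrelevance Pf Pg).
Qed.

HB.instance Definition _ := gen_eqMixin L2space.
HB.instance Definition _ := gen_choiceMixin L2space.

Lemma L2fun_L2 (x : L2space) : L2 mu x. Proof. exact: (L2funP x).1. Qed.
Hint Resolve L2fun_L2 : core.

Ltac L2tac := solve [repeat first [exact: L2fun_L2 | exact: L2_0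
  | apply: L2D | apply: L2B | apply: L2Z]].

Lemma L2class_subproof f :
  let g := L2rep (if pselect (L2 mu f) then f else cst 0) in
  L2 mu g /\ L2rep g = g.
Proof.
have Lg : L2 mu (if pselect (L2 mu f) then f else cst 0).
  by case: pselect => //= ?; exact: L2_0.
have [Lr gr] := L2repP Lg; split => //.
by apply: L2rep_ae; exact: ae_sym.
Qed.

(** Total: a function outside [L2] is sent to the class of 0. *)
Definition L2class f : L2space := MkL2space (L2class_subproof f).

Lemma L2class_ae f : L2 mu f -> L2fun (L2class f) = f %[ae mu].
Proof.
move=> Lf /=; case: pselect => //= ?; apply: ae_sym.
by have [] := L2repP Lf.
Qed.

Lemma L2classK (x : L2space) : L2class x = x.
Proof.
by apply: L2space_eq => /=; case: pselect => //= ?; exact: (L2funP x).2.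
Qed.

Lemma L2class_eq f g : L2 mu f -> L2 mu g -> f = g %[ae mu] ->
  L2class f = L2class g.
Proof.
move=> Lf Lg fg; apply: L2space_eq => /=.
by case: pselect => //= ?; case: pselect => //= ?; exact: L2rep_ae.
Qed.

Definition L2add (x y : L2space) := L2class (L2fun x \+ L2fun y).
Definition L2opp (x : L2space) := L2class (cst (-1) \* L2fun x).
Definition L2scale (a : R) (x : L2space) := L2class (cst a%:C \* L2fun x).

Lemma L2class_add f g : L2 mu f -> L2 mu g ->
  L2add (L2class f) (L2class g) = L2class (f \+ g).
Proof.
move=> Lf Lg; apply: L2class_eq; [exact: L2D|exact: L2D|].
by apply: filterS2 (L2class_ae Lf) (L2class_ae Lg) => x /= -> // ->.
Qed.

Lemma L2class_opp f : L2 mu f -> L2opp (L2class f) = L2class (cst (-1) \* f).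
Proof.
move=> Lf; apply: L2class_eq; [exact: L2Z|exact: L2Z|].
by apply: filterS (L2class_ae Lf) => x /= ->.
Qed.

Lemma L2class_scale a f : L2 mu f ->
  L2scale a (L2class f) = L2class (cst a%:C \* f).
Proof.
move=> Lf; apply: L2class_eq; [exact: L2Z|exact: L2Z|].
by apply: filterS (L2class_ae Lf) => x /= ->.
Qed.

Lemma L2addA : associative L2add.
Proof.
move=> x y z; rewrite -(L2classK x) -(L2classK y) -(L2classK z).
rewrite !L2class_add //; try L2tac.
by congr L2class; apply/funext => t /=; rewrite addrA.
Qed.

Lemma L2addC : commutative L2add.
Proof. by move=> x y; congr L2class; apply/funext => t /=; rewrite addrC. Qed.

Lemma L2add0 : left_id (L2class (cst 0)) L2add.
Proof.
move=> x; rewrite -(L2classK x) L2class_add //; try L2tac.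
by congr L2class; apply/funext => t /=; rewrite add0r.
Qed.

Lemma L2addN : left_inverse (L2class (cst 0)) L2opp L2add.
Proof.
move=> x; rewrite -(L2classK x) L2class_opp // L2class_add //; try L2tac.
by congr L2class; apply/funext => t /=; rewrite mulN1r addNr.
Qed.

HB.instance Definition _ :=
  GRing.isZmodule.Build L2space L2addA L2addC L2add0 L2addN.

Lemma L2scaleA a b (x : L2space) : L2scale a (L2scale b x) = L2scale (a * b) x.
Proof.
rewrite -(L2classK x) !L2class_scale //; try L2tac.
by congr L2class; apply/funext => t /=; rewrite rmorphM mulrA.
Qed.

Lemma L2scale1 : left_id 1 L2scale.
Proof.
move=> x; rewrite -(L2classK x) L2class_scale //.
by congr L2class; apply/funext => t /=; rewrite mul1r.
Qed.

Lemma L2scaleDr : right_distributive L2scale +%R.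
Proof.
move=> a x y; rewrite -(L2classK x) -(L2classK y).
rewrite [X in L2scale a X]L2class_add // !L2class_scale //; try L2tac.
rewrite [RHS]L2class_add //; try L2tac.
by congr L2class; apply/funext => t /=; rewrite mulrDr.
Qed.

Lemma L2scaleDl (x : L2space) : {morph L2scale^~ x : a b / a + b >-> a + b}.
Proof.
move=> a b /=; rewrite -(L2classK x) !L2class_scale //.
rewrite [RHS]L2class_add //; try L2tac.
by congr L2class; apply/funext => t /=; rewrite rmorphD mulrDl.
Qed.

HB.instance Definition _ := GRing.Zmodule_isLmodule.Build R L2space
  L2scaleA L2scale1 L2scaleDr L2scaleDl.

Lemma L2funD (x y : L2space) : L2fun (x + y) = L2fun x \+ L2fun y %[ae mu].
Proof. by apply: L2class_ae; exact: L2D. Qed.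

Lemma L2funZ a (x : L2space) : L2fun (a *: x) = cst a%:C \* L2fun x %[ae mu].
Proof. by apply: L2class_ae; exact: L2Z. Qed.

Lemma L2fun0 : L2fun (0 : L2space) = cst 0 %[ae mu].
Proof. by apply: L2class_ae; exact: L2_0. Qed.

Lemma L2space_ae (x y : L2space) : L2fun x = L2fun y %[ae mu] -> x = y.
Proof. by move=> xy; rewrite -(L2classK x) (L2class_eq _ _ xy) // L2classK. Qed.

Definition L2ip (x y : L2space) : R := re_ip mu x y.

Lemma L2ip_psd : psd_form setT L2ip.
Proof.
split => //.
- by move=> x y _ _; exact: re_ipC.
- move=> a x y z _ _ _; rewrite /L2ip -re_ip_lin //.
  apply: re_ip_ae => //; first exact: L2_lin.
  apply: filterS2 (L2funD (a *: x) y) (L2funZ a x) => t /= -> // ->//.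
- by move=> x _; exact: re_ip_ge0.
Qed.

Lemma L2ip_def x : L2ip x x = 0 -> x = 0.
Proof.
move=> /(re_ip_eq0 (L2fun_L2 x)) x0; apply: L2space_ae.
exact: ae_trans x0 (ae_sym L2fun0).
Qed.

Lemma L2ip_class f g : L2 mu f -> L2 mu g ->
  L2ip (L2class f) (L2class g) = re_ip mu f g.
Proof.
move=> Lf Lg; rewrite /L2ip (re_ip_ae _ Lf) //; last exact: L2class_ae.
by rewrite re_ipC (re_ip_ae _ Lg) 1?re_ipC //; exact: L2class_ae.
Qed.

Lemma L2class_lin a f g : L2 mu f -> L2 mu g ->
  L2class (cst a%:C \* f \+ g) = a *: L2class f + L2class g.
Proof.
move=> Lf Lg; rewrite [a *: _]L2class_scale // [RHS]L2class_add //; exact: L2Z.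
Qed.

Lemma L2classB f g : L2 mu f -> L2 mu g ->
  L2class (f \- g) = L2class f - L2class g.
Proof.
move=> Lf Lg; rewrite -scaleN1r addrC -L2class_lin //; congr L2class.
by apply/funext => t /=; rewrite rmorphN rmorph1 mulN1r addrC.
Qed.

Lemma cLnorm2_class f : L2 mu f -> cLnorm mu 2%:E f = (nrm L2ip (L2class f))%:E.
Proof. by move=> Lf; rewrite cLnorm2E // /nrm L2ip_class. Qed.

End L2_quotient.
#[global] Hint Resolve L2fun_L2 : core.

(** * Transfer of the form, its operator and the semigroup to classes *)

Lemma cvg_at_right0 (R : realType) (F : R -> \bar R) (G : R -> R) :
  (forall t, 0 < t -> F t = (G t)%:E) -> (forall t, 0 <= G t) ->
  F t @[t --> 0^'+] --> 0%E <->
  forall e : R, 0 < e -> exists2 d : R, 0 < d &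
    forall h : R, 0 < h -> h < d -> G h < e.
Proof.
move=> FG G0.
have nearFG : \forall t \near 0^'+, F t = (G t)%:E.
  by near=> t; apply: FG; near: t; exact: nbhs_right_gt.
have -> : F t @[t --> 0^'+] --> 0%E <-> G t @[t --> 0^'+] --> (0 : R).
  split=> [/fine_cvgP[_ H]|H].
    apply: cvg_trans H; apply: near_eq_cvg.
    by apply: filterS nearFG => t /= ->.
  have : (G t)%:E @[t --> 0^'+] --> 0%E by apply/fine_cvgP; split => //; exact: nearW.
  apply: cvg_trans; apply: near_eq_cvg.
  by apply: filterS nearFG => t /= ->.
split=> [/cvgrPdist_lt H e e0|H].
  have /nbhs_ballP[r /= r0 Hr] := H e e0.
  exists r => // h h0 hr; have := Hr h; move: hr.
  rewrite /ball /= !sub0r !normrN (gtr0_norm h0) ger0_norm // => hr /(_ hr h0); exact.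
apply/cvgrPdist_lt => e e0; have [r r0 Hr] := H e e0.
apply/nbhs_ballP; exists r => //= h; rewrite /ball /= sub0r normrN => hr h0.
rewrite sub0r normrN ger0_norm //; apply: Hr => //.
by rewrite gtr0_norm in hr.
Unshelve. all: by end_near. Qed.

Section dirichlet_hilbert.
Context {d : measure_display} {T : measurableType d} {R : realType}.
Variable mu : {measure set T -> \bar R}.
Variable E : L2form T R.
Implicit Types f g h : T -> R[i].
Hypotheses (aeE : ae_compatible mu E) (posE : positive_hermitian E).

Notation V := (L2space mu).

Definition form_dom : set V := [set x | dom E (L2fun x)].
Definition form_re (x y : V) : R := complex.Re (E (L2fun x) (L2fun y)).

Lemma dom_measurable f : dom E f -> cmeasurable f.
Proof. by move=> /(dom_L2 aeE)[]. Qed.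

Lemma dom_lin (c : R[i]) f g : dom E f -> dom E g -> dom E (cst c \* f \+ g).
Proof. by move=> Df Dg; apply: (dom_add posE) => //; exact: dom_scale. Qed.

Lemma domB f g : dom E f -> dom E g -> dom E (f \- g).
Proof.
move=> Df Dg; rewrite (_ : _ \- _ = cst (-1) \* g \+ f); first exact: dom_lin.
by apply/funext => x /=; rewrite mulN1r addrC.
Qed.

Lemma form_ae2 f f' g g' : dom E f -> dom E f' -> dom E g -> dom E g' ->
  f = f' %[ae mu] -> g = g' %[ae mu] -> E f g = E f' g'.
Proof.
move=> Df Df' Dg Dg' ff' gg'; rewrite (form_ae aeE Df Df' Dg ff').
by rewrite !(form_hermitian posE _ Df') // (form_ae aeE Dg Dg' Df' gg').
Qed.

Lemma form_linl (c : R[i]) f g h : dom E f -> dom E g -> dom E h ->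
  E (cst c \* f \+ g) h = c * E f h + E g h.
Proof.
move=> Df Dg Dh; rewrite (form_add posE) ?(form_scale posE) //.
exact: dom_scale.
Qed.

Lemma form_scaler (c : R[i]) f g : dom E f -> dom E g ->
  E f (cst c \* g) = c^* * E f g.
Proof.
move=> Df Dg; rewrite (form_hermitian posE (dom_scale posE c Dg) Df).
by rewrite (form_scale posE) // rmorphM /= -(form_hermitian posE Dg Df).
Qed.

Lemma dom_class f : dom E f -> dom E (L2fun (L2class mu f)).
Proof.
move=> Df; have Lf := dom_L2 aeE Df.
apply: (dom_ae aeE Df); first by have [] := L2fun_L2 (L2class mu f).
exact/ae_sym/L2class_ae.
Qed.

Lemma dom_class_inv f : L2 mu f -> dom E (L2fun (L2class mu f)) -> dom E f.
Proof.
by move=> Lf Dc; apply: (dom_ae aeE Dc); [case: Lf | exact: L2class_ae].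
Qed.

Lemma form_re_class f g : dom E f -> dom E g ->
  form_re (L2class mu f) (L2class mu g) = complex.Re (E f g).
Proof.
move=> Df Dg; congr complex.Re; apply: form_ae2 => //; try exact: dom_class.
  exact/L2class_ae/(dom_L2 aeE).
exact/L2class_ae/(dom_L2 aeE).
Qed.

Lemma form_re_psd : psd_form form_dom form_re.
Proof.
have ae_lin (a : R) (x y : V) :
    L2fun (a *: x + y) = cst a%:C \* L2fun x \+ L2fun y %[ae mu].
  by apply: filterS2 (L2funD (a *: x) y) (L2funZ a x) => t /= -> // ->.
have dom_lin' (a : R) (x y : V) : form_dom x -> form_dom y ->
    form_dom (a *: x + y).
  move=> Dx Dy; apply: (dom_ae aeE (dom_lin a%:C Dx Dy)).
    by have [] := L2fun_L2 (a *: x + y).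
  exact/ae_sym/ae_lin.
split => //.
- exact/dom_class/(dom_zero posE).
- move=> x y Dx Dy; rewrite /form_re (form_hermitian posE Dy Dx).
  by rewrite Re_conjc.
- move=> a x y z Dx Dy Dz; rewrite /form_re.
  rewrite (form_ae aeE (dom_lin' a x y Dx Dy) (dom_lin a%:C Dx Dy) Dz (ae_lin _ _ _)).
  by rewrite form_linl // Re_add Re_mul /= mul0r subr0.
- by move=> x Dx; have := form_ge0 posE Dx; rewrite lecE => /andP[].
Qed.

Lemma form_normE f : dom E f -> form_norm mu E f =
  Num.sqrt (graph_form (@L2ip _ _ _ mu) form_re (L2class mu f) (L2class mu f)).
Proof.
move=> Df; have Lf := dom_L2 aeE Df.
rewrite /form_norm cLnorm2E //= sqr_sqrtr ?re_ip_ge0 //.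
by rewrite /graph_form form_re_class // L2ip_class.
Qed.

Lemma dirichlet_hilbert : densely_defined mu E -> closed_form mu E ->
  hilbert_form (@L2ip _ _ _ mu) form_dom form_re.
Proof.
move=> densE closE; split.
- exact: L2ip_psd.
- exact: L2ip_def.
- exact: form_re_psd.
- move=> f Df cauf.
  have [|g Dg cvg_g] := closE (fun n => L2fun (f n)) Df.
    move=> e e0; have [N HN] := cauf _ (exprn_gt0 2 e0).
    exists N => m n Nm Nn; rewrite form_normE; last exact: domB (Df m) (Df n).
    rewrite L2classB // !L2classK -(gtr0_norm e0) -sqrtr_sqr ltr_sqrt ?exprn_gt0 //.
    exact: HN.
  exists (L2class mu g); first exact: dom_class.
  move=> e e0; have s0 : 0 < Num.sqrt e by rewrite sqrtr_gt0.
  have /cvgrPdist_lt /(_ _ s0) [N _ HN] := cvg_g.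
  exists N => n Nn; have := HN n Nn; rewrite /= sub0r normrN.
  rewrite form_normE; last exact: domB (Df n) Dg.
  rewrite L2classB //; last exact: (dom_L2 aeE).
  by rewrite L2classK ger0_norm ?sqrtr_ge0 // ltr_sqrt.
- move=> x e e0; have s0 : 0 < Num.sqrt e by rewrite sqrtr_gt0.
  have [g Dg] := densE (L2fun x) (L2fun_L2 x) _ s0.
  have Lg := dom_L2 aeE Dg; rewrite /L2dist cLnorm2_class; last exact: L2B.
  rewrite L2classB // L2classK lte_fin => xg.
  exists (L2class mu g); first exact: dom_class.
  by move: xg; rewrite /nrm ltr_sqrt.
Qed.

(** Equality of the real parts for all test functions gives that of the imaginary parts on replacing
    [h] by ['i * h]. *)
Lemma form_operatorP (x y : V) :
  form_operator (@L2ip _ _ _ mu) form_dom form_re x y <->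
  associated_operator mu E (L2fun x) (L2fun y).
Proof.
split=> [[Dx Hx]|[Dx Ly Hx]]; last first.
  by split => // h Dh; rewrite /form_re Hx.
split => // h Dh.
have re_eq h' : dom E h' -> complex.Re (E (L2fun x) h') = re_ip mu (L2fun y) h'.
  move=> Dh'; have Lh' := dom_L2 aeE Dh'.
  have := Hx _ (dom_class Dh'); rewrite -{1}(L2classK x) form_re_class //.
  by rewrite -{1}(L2classK y) L2ip_class.
apply: complex_eq; first exact: re_eq.
have := re_eq _ (dom_scale posE 'i Dh); rewrite form_scaler // Re_mul /=.
rewrite mul0r sub0r mulN1r opprK => ->.
apply: eq_Rintegral => t _ /=.
by rewrite Re_mul Im_mul !Re_conjc !Im_conjc Re_mul Im_mul /=; ring.
Qed.

Variable S : R -> (T -> R[i]) -> (T -> R[i]).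
Hypothesis SE : semigroup_generated_by mu (associated_operator mu E) S.

Definition semigroup_class (t : R) (x : V) : V := L2class mu (S t (L2fun x)).

Lemma semigroup_classE t f : 0 <= t -> L2 mu f ->
  semigroup_class t (L2class mu f) = L2class mu (S t f).
Proof.
move=> t0 Lf; have B := sg_bounded SE.1 t0; apply: L2class_eq.
- exact: (bop_L2 B).
- exact: (bop_L2 B).
- by apply: (bop_ae B) => //; exact: L2class_ae.
Qed.

Lemma semigroup_class_of :
  semigroup_of (@L2ip _ _ _ mu) form_dom form_re semigroup_class.
Proof.
have [[SB S0 SD SC] SG] := SE.
have LS t f : 0 <= t -> L2 mu f -> L2 mu (S t f).
  by move=> t0; exact: (bop_L2 (SB t t0)).
split.
- move=> t t0 a x y.
  rewrite -[in LHS](L2classK x) -[in LHS](L2classK y) -L2class_lin //.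
  rewrite semigroup_classE //; last exact: L2_lin.
  rewrite /semigroup_class -L2class_lin; try exact: LS.
  apply: L2class_eq; first exact/LS/L2_lin.
    by apply: L2_lin; exact: LS.
  exact: (bop_linear (SB t t0)).
- move=> t t0; have [M HM] := bop_bounded (SB t t0); exists M => x.
  have := HM _ (L2fun_L2 x); rewrite !cLnorm2_class //; last exact: LS.
  by rewrite L2classK -EFinM lee_fin.
- move=> x; rewrite -[RHS]L2classK; apply: L2class_eq => //.
    exact: LS.
  exact: S0.
- move=> s t x s0 t0; rewrite {3}/semigroup_class semigroup_classE //; last exact: LS.
  apply: L2class_eq; [apply: LS => //; exact: addr_ge0 | exact/LS/LS | exact: SD].
- move=> x; have /cvg_at_right0 := SC _ (L2fun_L2 x); apply.
    move=> t t0; rewrite /L2dist cLnorm2_class ?L2classB ?L2classK //.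
    + exact/LS/L2fun_L2/ltW.
    + by apply: L2B => //; exact/LS/L2fun_L2/ltW.
  by move=> t; exact: sqrtr_ge0.
move=> x y; rewrite form_operatorP SG //; apply: cvg_at_right0; last first.
  by move=> t; exact: sqrtr_ge0.
move=> t t0; have LSx : L2 mu (S t (L2fun x)) by exact/LS/L2fun_L2/ltW.
have LD : L2 mu (L2fun x \- S t (L2fun x)) by exact: L2B.
have LZ := L2Z (t^-1)%:C LD.
have eZ : t^-1 *: L2class mu (L2fun x \- S t (L2fun x)) =
  L2class mu (cst (t^-1)%:C \* (L2fun x \- S t (L2fun x))).
  exact: L2class_scale.
rewrite /L2dist cLnorm2_class; last exact: (L2B LZ (L2fun_L2 y)).
rewrite (L2classB LZ (L2fun_L2 y)) -eZ (L2classB (L2fun_L2 x) LSx).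
by rewrite !L2classK.
Qed.

End dirichlet_hilbert.

(** * Truncations and products in a Dirichlet form domain *)

(* [F s] is the integral of [min x r] over [0 <= r <= s]. *)
Lemma min_riemann_sum (R : realFieldType) (x h : R) (n : nat) :
  0 <= x -> 0 <= h ->
  let F (s : R) : R := if x <= s then x * s - x ^+ 2 / 2 else s ^+ 2 / 2 in
  let A : R := h * \sum_(k < n) Num.min x (k.+1%:R * h) in
  F (n%:R * h) <= A /\ A <= F (n%:R * h) + h * Num.min x (n%:R * h).
Proof.
move=> x0 h0 F /=; elim: n => [|n [IH1 IH2]].
  rewrite big_ord0 !mul0r mulr0 /F.
  have -> : Num.min x 0 = 0 by apply/min_idPr.
  by case: ifPn => [x0'|_]; [have -> : x = 0 by lra | ]; rewrite expr0n /=; lra.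
have s0 : 0 <= n%:R * h by rewrite mulr_ge0.
have up : F (n%:R * h + h) <= F (n%:R * h) + h * Num.min x (n%:R * h + h).
  rewrite /F; move: (n%:R * h) s0 => s s0.
  by case: (leP x s) => xs; case: (leP x (s + h)) => xsh; nra.
have low : F (n%:R * h) + h * Num.min x (n%:R * h) <= F (n%:R * h + h).
  rewrite /F; move: (n%:R * h) s0 => s s0.
  by case: (leP x s) => xs; case: (leP x (s + h)) => xsh; nra.
have nS : n.+1%:R * h = n%:R * h + h by rewrite -natr1 mulrDl mul1r.
rewrite big_ord_recr /= nS mulrDr.
by split; lra.
Qed.

(* Riemann sums for [x ^ 2 = 2 x - 2 * \int_0^1 min x s ds], valid on [0, 1]; the
   energy of each truncation [min u s] is at most that of [u], by the Markov
   property. *)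
Definition square_approx {R : realFieldType} (N : nat) (x : R) : R :=
  2 * x + - (2 * N.+1%:R^-1) * \sum_(k < N.+1) Num.min x (k.+1%:R * N.+1%:R^-1).

(** By [min_riemann_sum] the Riemann sum errs by at most [N.+1%:R^-1 * x]. The factor [x] matters:
    on a space of possibly infinite measure it keeps the error square-integrable along with u. *)
Lemma square_approx_dist (R : realFieldType) (N : nat) (x : R) :
  0 <= x -> x <= 1 ->
  (square_approx N x - x ^+ 2) ^+ 2 <= (2 * N.+1%:R^-1) ^+ 2 * x ^+ 2.
Proof.
move=> x0 x1; rewrite /square_approx; set h := N.+1%:R^-1.
have h0 : 0 <= h by rewrite invr_ge0.
have [] := min_riemann_sum N.+1 x0 h0.
have -> : N.+1%:R * h = 1 by rewrite divff // pnatr_eq0.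
rewrite x1 (min_idPl x1) mulNr -(mulrA 2 h).
move: (h * \sum_(_ < _) _) => A A1 A2.
have hx : 0 <= h * x by exact: mulr_ge0.
by rewrite -exprMn -sqrrN ler_sqr ?nnegrE; lra.
Qed.

Section dirichlet_algebra.
Context {d : measure_display} {T : measurableType d} {R : realType}.
Variable mu : {measure set T -> \bar R}.
Variable E : L2form T R.
Implicit Types (f g h : T -> R[i]) (u v : T -> R).
Hypothesis dirE : dirichlet_form mu E.

Let aeE := dirichlet_ae dirE.
Let posE := dirichlet_positive dirE.
Let hilE := dirichlet_hilbert aeE posE (dirichlet_dense dirE) (dirichlet_closed dirE).

Local Notation domR u := (dom E (cplx u)).
Let Q u : R := complex.Re (E (cplx u) (cplx u)).

Lemma domR_scale (a : R) u : domR u -> domR (fun x => a * u x).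
Proof.
move=> Du; have -> : cplx (fun x => a * u x) = cst a%:C \* cplx u.
  by apply/funext => x; rewrite /cplx /= rmorphM.
exact: (dom_scale posE).
Qed.

Lemma cplxD u v : cplx (fun x => u x + v x) = cplx u \+ cplx v.
Proof. by apply/funext => x; rewrite /cplx /= rmorphD. Qed.

Lemma domR_add u v : domR u -> domR v -> domR (fun x => u x + v x).
Proof. by move=> Du Dv; rewrite cplxD; exact: (dom_add posE). Qed.

Lemma domR_measurable u : domR u -> measurable_fun [set: T] u.
Proof. by move=> /(dom_measurable aeE)[]. Qed.

Lemma cmeasurable_cplx u : measurable_fun [set: T] u -> cmeasurable (cplx u).
Proof. by move=> mu_; split => //; exact: measurable_cst. Qed.

Lemma domR_ae u v : domR u -> measurable_fun [set: T] v -> u = v %[ae mu] -> domR v.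
Proof.
move=> Du mv uv; apply: (dom_ae aeE Du); first exact: cmeasurable_cplx.
by apply: filterS uv => x uv _; rewrite /cplx uv.
Qed.

Lemma dom_Re f : dom E f -> domR (fun x => complex.Re (f x)).
Proof.
move=> Df; have [Dc _] := dirichlet_real dirE Df.
have -> : cplx (fun x => complex.Re (f x)) = cst (2^-1)%:C \* (f \+ cconj f).
  apply/funext => x; rewrite /cplx /cconj /=; apply: complex_eq.
    by rewrite Re_mul Re_add Im_add Re_conjc Im_conjc subrr mulr0 subr0 /=; field.
  by rewrite Im_mul Re_add Im_add Re_conjc Im_conjc subrr mulr0 add0r /= mul0r.
exact/(dom_scale posE)/(dom_add posE).
Qed.

Lemma dom_Im f : dom E f -> domR (fun x => complex.Im (f x)).
Proof.
move=> Df; have := dom_Re (dom_scale posE (- 'i) Df).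
rewrite (_ : (fun x => complex.Re _) = fun x => complex.Im (f x)) //.
by apply/funext => x /=; rewrite Re_mul /=; ring.
Qed.

Lemma dom_parts f : domR (fun x => complex.Re (f x)) ->
  domR (fun x => complex.Im (f x)) -> dom E f.
Proof.
move=> Dr Di; have := dom_lin posE 'i Di Dr.
rewrite (_ : _ \+ _ = f) //.
apply/funext => x; apply: complex_eq.
  by rewrite /cplx /=; case: (f x) => a b /=; ring.
by rewrite /cplx /=; case: (f x) => a b /=; ring.
Qed.

Lemma L2_dominated (c : R) f g : L2 mu f -> cmeasurable g ->
  (forall x, re_dot g g x <= c * re_dot f f x) ->
  L2 mu g /\ re_ip mu g g <= c * re_ip mu f f.
Proof.
move=> Lf mg gf; have ff := integrable_re_dot Lf Lf.
have cff := integrableZl measurableT c ff.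
have Lg : L2 mu g.
  apply/L2P; split => //; apply: le_integrable cff => //.
    by apply/measurable_EFinP; exact: measurable_re_dot.
  move=> x _ /=; rewrite lee_fin ger0_norm ?re_dot_ge0 //.
  by apply: le_trans (gf x) _; exact: ler_norm.
split => //; rewrite !re_ipE -RintegralZl //.
by apply: le_Rintegral => //; exact: integrable_re_dot.
Qed.

Lemma dom_lsc f (C : R) : L2 mu f ->
  (forall e : R, 0 < e -> exists2 g, dom E g &
     complex.Re (E g g) <= C /\ re_ip mu (g \- f) (g \- f) <= e) -> dom E f.
Proof.
move=> Lf H; apply: (dom_class_inv aeE Lf).
apply: (form_lsc hilE (C := C)) => e e0; have [g Dg [Eg gf]] := H e e0.
have Lg := dom_L2 aeE Dg.
exists (L2class mu g); first exact: (dom_class aeE).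
rewrite (form_re_class aeE posE Dg Dg) -(L2classB Lg Lf).
by rewrite (L2ip_class (L2B Lg Lf) (L2B Lg Lf)).
Qed.

Lemma energy_ge0 f : dom E f -> 0 <= complex.Re (E f f).
Proof. by move=> Df; have := form_ge0 posE Df; rewrite lecE => /andP[]. Qed.

Lemma energy_add_sqr (s r c : R) f g : dom E f -> dom E g ->
  0 <= s -> 0 <= r -> 0 <= c ->
  complex.Re (E f f) <= s ^+ 2 * c -> complex.Re (E g g) <= r ^+ 2 * c ->
  complex.Re (E (f \+ g) (f \+ g)) <= (s + r) ^+ 2 * c.
Proof.
move=> Df Dg s0 r0 c0; have Dfg := dom_add posE Df Dg.
rewrite -(form_re_class aeE posE Df Df) -(form_re_class aeE posE Dg Dg).
rewrite -(form_re_class aeE posE Dfg Dfg) => Ef Eg.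
have -> : L2class mu (f \+ g) = L2class mu f + L2class mu g.
  by rewrite [RHS]L2class_add //; exact: (dom_L2 aeE).
apply: (psd_add_sqr (form_re_psd aeE posE)) => //.
  exact: (dom_class aeE Df).
exact: (dom_class aeE Dg).
Qed.

Lemma energy_scale (a : R) u : domR u -> Q (fun x => a * u x) = a ^+ 2 * Q u.
Proof.
move=> Du; have -> : Q (fun x => a * u x) =
    complex.Re (E (cst a%:C \* cplx u) (cst a%:C \* cplx u)).
  by congr (complex.Re (E _ _)); apply/funext => x; rewrite /cplx /= rmorphM.
have Da := dom_scale posE a%:C Du.
rewrite (form_scale posE) // (form_scaler posE) // !Re_mul /=.
rewrite -/(Q u).
ring.
Qed.

Lemma domR_clip u : domR u -> domR (fun x => Num.min (Num.max (u x) 0) 1) /\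
  Q (fun x => Num.min (Num.max (u x) 0) 1) <= Q u.
Proof.
move=> /(dirichlet_markov dirE)[Dv]; rewrite lecE => /andP[_ QE].
by split.
Qed.

(** The truncation at [s] is s times the unit truncation of [u / s], and the factors [s ^+ 2] in the
    energies cancel. *)
Lemma domR_min (s : R) u : domR u -> (forall x, 0 <= u x) -> 0 < s ->
  domR (fun x => Num.min (u x) s) /\ Q (fun x => Num.min (u x) s) <= Q u.
Proof.
move=> Du u0 s0; have [Dv Qv] := domR_clip (domR_scale s^-1 Du).
have -> : (fun x => Num.min (u x) s) =
    (fun x => s * Num.min (Num.max (s^-1 * u x) 0) 1).
  apply/funext => x; have -> : Num.max (s^-1 * u x) 0 = s^-1 * u x.
    by apply/max_idPl; rewrite mulr_ge0 // invr_ge0 ltW.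
  by rewrite minr_pMr ?(ltW s0) // mulrA divff ?gt_eqF // mul1r mulr1.
split; first exact: domR_scale.
rewrite energy_scale //; move: Qv; rewrite energy_scale // => Qv.
apply: (le_trans (ler_wpM2l (sqr_ge0 s) Qv)).
by rewrite mulrA -exprMn divff ?gt_eqF // expr1n mul1r.
Qed.

Lemma domR_sum (v : nat -> T -> R) (c : R) n : 0 <= c ->
  (forall k, domR (v k) /\ Q (v k) <= c) ->
  domR (fun x => \sum_(k < n) v k x) /\
  Q (fun x => \sum_(k < n) v k x) <= n%:R ^+ 2 * c.
Proof.
move=> c0 H; elim: n => [|n [Dn Qn]].
  have -> : (fun x => \sum_(k < 0) v k x) = (fun x => 0 * v 0%N x).
    by apply/funext => x; rewrite big_ord0 mul0r.
  have [D0 _] := H 0%N; split; first exact: domR_scale.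
  by rewrite energy_scale // expr0n /= !mul0r.
have -> : (fun x => \sum_(k < n.+1) v k x) =
    (fun x => \sum_(k < n) v k x + v n x).
  by apply/funext => x; rewrite big_ord_recr.
have [Dv Qv] := H n; split; first exact: domR_add.
rewrite /Q cplxD -natr1; apply: energy_add_sqr => //.
by rewrite expr1n mul1r.
Qed.

End dirichlet_algebra.

(** * Products of bounded elements of the form domain *)

Lemma Lnorm_oo_ltyP {d : measure_display} {T : measurableType d} {R : realType}
  (mu : {measure set T -> \bar R}) (u : T -> R) :
  ('N[mu]_+oo[EFin \o u] < +oo)%E <->
  exists2 M : R, 0 < M & \forall x \ae mu, `|u x| <= M.
Proof.
have abs_u : abse \o (EFin \o u) = EFin \o (Num.norm \o u) by apply/funext.
rewrite unlock abs_u; case: ifPn => [mu0|muN0]; last first.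
  split=> // _; exists 1 => //; exists setT; split => //.
  by apply/eqP; rewrite eq_le measure_ge0 andbT leNgt.
split=> [/ess_supr_bounded[M HM]|[M M0 HM]].
  exists (`|M| + 1); first by rewrite ltr_wpDl.
  apply: filterS HM => x /= /le_trans; apply.
  by have := ler_norm M; lra.
by apply: le_lt_trans (ltry M); apply/ess_supP.
Qed.

Lemma clip_sqr (R : realFieldType) (t : R) : `|t| <= 1 ->
  Num.min (Num.max t 0) 1 ^+ 2 + Num.min (Num.max (- t) 0) 1 ^+ 2 = t ^+ 2.
Proof.
rewrite ler_norml => /andP[t1 t2].
have [t0|t0] := leP 0 t.
  have -> : Num.max (- t) 0 = 0 by rewrite max_r // oppr_le0.
  by rewrite !min_l // expr0n addr0.
have -> : Num.max (- t) 0 = - t by rewrite max_l // oppr_ge0 ltW.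
by rewrite !min_l ?sqrrN ?expr0n ?add0r //; lra.
Qed.

Section dirichlet_products.
Context {d : measure_display} {T : measurableType d} {R : realType}.
Variable mu : {measure set T -> \bar R}.
Variable E : L2form T R.
Implicit Types (f g h : T -> R[i]) (u v : T -> R).
Hypothesis dirE : dirichlet_form mu E.

Let aeE := dirichlet_ae dirE.
Let posE := dirichlet_positive dirE.

Local Notation domR u := (dom E (cplx u)).
Local Notation Q u := (complex.Re (E (cplx u) (cplx u))).

(** The functions [square_approx N (u x)] combine [u] and its truncations, have energy bounded
    independently of N, and tend to the square in L2; lower semicontinuity concludes. *)
Lemma domR_square01 u : domR u -> (forall x, 0 <= u x) -> (forall x, u x <= 1) ->
  domR (fun x => u x ^+ 2).
Proof.
move=> Du u0 u1; have Lu := dom_L2 aeE Du.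
have Qu0 := energy_ge0 dirE Du.
have mu2 : cmeasurable (cplx (fun x => u x ^+ 2)).
  exact/cmeasurable_cplx/measurable_funX/(domR_measurable dirE Du).
have Lu2 : L2 mu (cplx (fun x => u x ^+ 2)).
  suff le_u x : re_dot (cplx (fun x => u x ^+ 2)) (cplx (fun x => u x ^+ 2)) x
      <= 1 * re_dot (cplx u) (cplx u) x by have [] := L2_dominated Lu mu2 le_u.
  rewrite mul1r /re_dot /cplx /=.
  rewrite !mulr0 !addr0 -(expr2 (u x)) ler_piMr ?sqr_ge0 //.
  by rewrite exprn_ile1 ?u0 ?u1.
apply: (dom_lsc dirE (C := 16 * Q u) Lu2) => e e0.
have K0 := re_ip_ge0 mu (cplx u).
have d0 : 0 < e / (4 * (re_ip mu (cplx u) (cplx u) + 1)).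
  by rewrite divr_gt0 // mulr_gt0 // ltr_wpDl.
have [N HN] := natSinv_lt d0.
have {HN} := HN N (leqnn N).
have h0 : 0 < N.+1%:R^-1 :> R by rewrite invr_gt0.
have h1 : N.+1%:R^-1 <= 1 :> R by rewrite invf_le1 // ler1n.
have Nh : N.+1%:R * N.+1%:R^-1 = 1 :> R by rewrite divff // pnatr_eq0.
pose v k x := Num.min (u x) (k.+1%:R * N.+1%:R^-1).
have vP k : domR (v k) /\ Q (v k) <= Q u.
  by apply: (domR_min dirE Du u0); rewrite mulr_gt0.
have [Ds Qs] := domR_sum dirE N.+1 Qu0 vP.
have wE : (fun x => square_approx N (u x)) =
    (fun x => 2 * u x + - (2 * N.+1%:R^-1) * \sum_(k < N.+1) v k x) by [].
have Dw : domR (fun x => square_approx N (u x)).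
  by rewrite wE; apply: (domR_add dirE); exact: (domR_scale dirE).
move: wE h0 h1 Nh Qs.
set h : R := N.+1%:R^-1 => wE h0 h1 Nh Qs hd.
exists (cplx (fun x => square_approx N (u x))) => //; split.
  rewrite wE cplxD.
  (* In Minkowski's inequality [2 * u] contributes 2. So do the [N.+1] truncations, each of energy
     at most [Q u], with weight [2 * h] and [N.+1%:R * h = 1]. *)
  have -> : 16 * Q u = (2 + 2) ^+ 2 * Q u by ring.
  apply: (energy_add_sqr dirE) => //; try exact: (domR_scale dirE).
    by rewrite (energy_scale dirE).
  rewrite (energy_scale dirE) // sqrrN.
  apply: (le_trans (ler_wpM2l (sqr_ge0 _) Qs)).
  by rewrite mulrA -exprMn -(mulrA 2 h) (mulrC h) Nh mulr1.
have mw := (L2B (dom_L2 aeE Dw) Lu2).1.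
have [_ H] : L2 mu (cplx (fun x => square_approx N (u x)) \- cplx (fun x => u x ^+ 2)) /\
    re_ip mu (cplx (fun x => square_approx N (u x)) \- cplx (fun x => u x ^+ 2))
     (cplx (fun x => square_approx N (u x)) \- cplx (fun x => u x ^+ 2))
    <= (2 * h) ^+ 2 * re_ip mu (cplx u) (cplx u).
  apply: (L2_dominated Lu mw) => x; rewrite /re_dot /cplx /=.
  by rewrite subr0 !mulr0 !addr0 -!expr2; exact: square_approx_dist.
apply: (le_trans H).
move: hd; rewrite ltr_pdivlMr ?mulr_gt0 ?ltr_wpDl // => hd.
move: K0 hd; move: (re_ip _ _ _) => K K0 hd.
have : h ^+ 2 <= h by rewrite expr2 ler_piMl // ltW.
nra.
Qed.

(** After division by [M], the square is the sum of the squares of the truncations of [u] and [- u]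
    to the unit interval, almost everywhere. *)
Lemma domR_square (M : R) u : 0 < M -> domR u ->
  (\forall x \ae mu, `|u x| <= M) -> domR (fun x => u x ^+ 2).
Proof.
move=> M0 Du uM.
pose clip (v : T -> R) x := Num.min (Num.max (v x) 0) 1.
pose up := clip (fun x => M^-1 * u x); pose un := clip (fun x => - M^-1 * u x).
have sq v : domR v -> domR (fun x => clip v x ^+ 2).
  move=> Dv; have [Dc _] := domR_clip dirE Dv.
  apply: domR_square01 => // x; first by rewrite le_min le_max lexx orbT ler01.
  by rewrite ge_min lexx orbT.
have D2 : domR (fun x => M ^+ 2 * (up x ^+ 2 + un x ^+ 2)).
  by apply/(domR_scale dirE)/(domR_add dirE); apply: sq; exact: (domR_scale dirE).
apply: (domR_ae dirE D2).
  exact/measurable_funX/(domR_measurable dirE Du).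
apply: filterS uM => x + _; rewrite /up /un /clip => uxM.
have -> : u x ^+ 2 = (M * (M^-1 * u x)) ^+ 2.
  by rewrite mulrA divff ?mul1r // gt_eqF.
rewrite mulNr.
have t1 : `|M^-1 * u x| <= 1.
  by rewrite normrM gtr0_norm ?invr_gt0 // mulrC ler_pdivrMr // mul1r.
rewrite exprMn; congr (_ * _); exact: clip_sqr.
Qed.

Lemma domR_mul (M : R) u v : 0 < M -> domR u -> domR v ->
  (\forall x \ae mu, `|u x| <= M) -> (\forall x \ae mu, `|v x| <= M) ->
  domR (fun x => u x * v x).
Proof.
move=> M0 Du Dv uM vM.
have M20 : 0 < M + M by rewrite addr_gt0.
have Dp : domR (fun x => (u x + v x) ^+ 2).
  apply: (domR_square M20); first exact: (domR_add dirE).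
  apply: filterS2 uM vM => x ux vx.
  by apply: le_trans (ler_normD _ _) _; exact: lerD.
have Dm : domR (fun x => (u x + -1 * v x) ^+ 2).
  apply: (domR_square M20).
    by apply: (domR_add dirE) => //; exact: (domR_scale dirE).
  apply: filterS2 uM vM => x ux vx; rewrite mulN1r.
  by apply: le_trans (ler_normB _ _) _; exact: lerD.
have := domR_add dirE (domR_scale dirE 4^-1 Dp) (domR_scale dirE (- 4^-1) Dm).
rewrite (_ : (fun x => _) = fun x => u x * v x) //.
by apply/funext => x; field.
Qed.

End dirichlet_products.

(** * Restriction to a measurable set *)

Section restriction.
Context {d : measure_display} {T : measurableType d} {R : realType}.
Variable mu : {measure set T -> \bar R}.
Variable A : set T.
Hypothesis mA : measurable A.
Implicit Types f g : T -> R[i].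

Definition restr f : T -> R[i] := cplx \1_A \* f.

Lemma restrE f x : restr f x = (\1_A x)%:C * f x.
Proof. by []. Qed.

Lemma indic01 (x : T) : \1_A x = 0 :> R \/ \1_A x = 1 :> R.
Proof. by rewrite indicE; case: (x \in A); [right|left]. Qed.

Lemma Re_restr f x : complex.Re (restr f x) = \1_A x * complex.Re (f x).
Proof. by rewrite restrE Re_mul /= mul0r subr0. Qed.

Lemma Im_restr f x : complex.Im (restr f x) = \1_A x * complex.Im (f x).
Proof. by rewrite restrE Im_mul /= mul0r addr0. Qed.

Lemma restr_id f x : restr (restr f) x = restr f x.
Proof.
by rewrite !restrE mulrA -rmorphM; case: (indic01 x) => ->; rewrite ?mul0r ?mul1r.
Qed.

Lemma cmeasurable_restr f : cmeasurable f -> cmeasurable (restr f).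
Proof.
move=> [rf if_]; split.
- by under eq_fun do rewrite Re_restr; apply: measurable_funM.
- by under eq_fun do rewrite Im_restr; apply: measurable_funM.
Qed.

Lemma re_dot_restr f g x : re_dot (restr f) g x = re_dot f (restr g) x.
Proof. by rewrite /re_dot !Re_restr !Im_restr; ring. Qed.

Lemma L2_restr f : L2 mu f -> L2 mu (restr f).
Proof.
move=> Lf; suff le_f x : re_dot (restr f) (restr f) x <= 1 * re_dot f f x.
  by have [] := L2_dominated Lf (cmeasurable_restr Lf.1) le_f.
rewrite /re_dot !Re_restr !Im_restr mul1r.
by case: (indic01 x) => ->; rewrite ?mul1r // !mul0r addr0 re_dot_ge0.
Qed.

Lemma restr_ae f g : f = g %[ae mu] -> restr f = restr g %[ae mu].
Proof. by apply: filterS => x fg _; rewrite !restrE fg. Qed.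

Lemma L2onP f : L2on mu A f <-> L2 mu f /\ restr f = f %[ae mu].
Proof.
split=> [[Lf f0]|[Lf f0]]; split => //.
  apply: filterS f0 => x f0 _; rewrite restrE indicE.
  have [xA|xA] := boolP (x \in A); first by rewrite mul1r.
  by rewrite mul0r f0 // => /mem_set; rewrite (negbTE xA).
apply: filterS f0 => x /(_ I) <- Ax.
by rewrite restrE indicE memNset // mul0r.
Qed.

Definition proj (x : L2space mu) : L2space mu := L2class mu (restr (L2fun x)).

Lemma proj_class f : L2 mu f -> proj (L2class mu f) = L2class mu (restr f).
Proof.
move=> Lf; apply: L2class_eq; try exact: L2_restr.
by apply: restr_ae; exact: L2class_ae.
Qed.

Lemma proj_lin : lin proj.
Proof.
move=> a x y; rewrite -[in LHS](L2classK x) -[in LHS](L2classK y).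
rewrite -L2class_lin // proj_class; last exact: L2_lin.
rewrite /proj -L2class_lin; try exact: L2_restr.
congr L2class; apply/funext => t; rewrite /= !restrE /=.
by rewrite mulrDr mulrCA.
Qed.

Lemma proj_sym x y : L2ip (proj x) y = L2ip x (proj y).
Proof.
rewrite -[in LHS](L2classK y) -[in RHS](L2classK x).
rewrite !L2ip_class //; try exact: L2_restr.
by rewrite !re_ipE; apply: eq_Rintegral => t _; exact: re_dot_restr.
Qed.

Lemma proj_idem x : proj (proj x) = proj x.
Proof.
rewrite {2}/proj proj_class; last exact: L2_restr.
by congr L2class; apply/funext => t; exact: restr_id.
Qed.

Lemma L2on_proj f : L2 mu f ->
  L2on mu A f <-> proj (L2class mu f) = L2class mu f.
Proof.
move=> Lf; have Lr := L2_restr Lf; rewrite L2onP proj_class //; split=> [[_ fr]|fr].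
  exact: L2class_eq.
split => //; apply: ae_trans (ae_sym (L2class_ae Lr)) _.
by rewrite fr; exact: L2class_ae.
Qed.

Variable E : L2form T R.
Hypothesis dirE : dirichlet_form mu E.
Hypothesis localE : local_form mu E.

Let aeE := dirichlet_ae dirE.
Let posE := dirichlet_positive dirE.
Let hilE := dirichlet_hilbert aeE posE (dirichlet_dense dirE) (dirichlet_closed dirE).

Lemma form_restr_orth f g : dom E (restr f) -> dom E (g \- restr g) ->
  E (restr f) (g \- restr g) = 0.
Proof.
move=> Df Dg; apply: (localE (a := 0)) => //; apply: aeW => x _ /=.
by rewrite !restrE addr0; case: (indic01 x) => ->; rewrite !(mul0r, mul1r, subrr, mulr0).
Qed.

(** Locality makes [restr f] and [f \- restr f] orthogonal for [E], so the energy of [f] is the sum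
    of theirs. *)
Lemma energy_restr_le f : dom E f -> dom E (restr f) ->
  complex.Re (E (restr f) (restr f)) <= complex.Re (E f f).
Proof.
move=> Df Dr; have Dq := domB posE Df Dr.
have orth := form_restr_orth Dr Dq.
have fE : f = restr f \+ (f \- restr f).
  by apply/funext => x /=; rewrite addrC subrK.
have Efr : E f (restr f) = E (restr f) (restr f).
  rewrite {1}fE (form_add posE) // (form_hermitian posE Dr Dq) orth.
  by rewrite rmorph0 addr0.
have Eff : E f f = E (restr f) (restr f) + E (f \- restr f) (f \- restr f).
  rewrite {1}fE (form_add posE) //; congr (_ + _).
    by rewrite (form_hermitian posE Df Dr) Efr -(form_hermitian posE Dr Dr).
  rewrite {3}fE (form_hermitian posE (dom_add posE Dr Dq) Dq).
  rewrite (form_add posE) // orth add0r.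
  by rewrite -(form_hermitian posE Dq Dq).
by rewrite Eff Re_add lerDl (energy_ge0 dirE).
Qed.

Variable S : R -> (T -> R[i]) -> (T -> R[i]).
Hypothesis SE : semigroup_generated_by mu (associated_operator mu E) S.

Let LS t f : 0 <= t -> L2 mu f -> L2 mu (S t f).
Proof. by move=> t0; exact: (bop_L2 (sg_bounded SE.1 t0)). Qed.

Lemma invariant_dom t : 0 < t ->
  (forall f, L2on mu A f -> L2on mu A (S t f)) ->
  forall f, dom E f -> dom E (restr f).
Proof.
move=> t0 inv f Df; have Lf := dom_L2 aeE Df.
apply: (dom_class_inv aeE (L2_restr Lf)); rewrite -proj_class //.
apply: (form_dom_invariant hilE (semigroup_class_of aeE posE SE) proj_lin
  proj_sym proj_idem t0); last exact: (dom_class aeE Df).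
move=> x; apply/(L2on_proj (LS (ltW t0) (L2fun_L2 _)))/inv.
by apply/(L2on_proj (L2fun_L2 _)); rewrite L2classK proj_idem.
Qed.

Lemma dom_invariant : (forall f, dom E f -> dom E (restr f)) ->
  forall t, 0 < t -> forall f, L2on mu A f -> L2on mu A (S t f).
Proof.
move=> DA t t0 f fA; have Lf := fA.1.
have := (L2on_proj Lf).1 fA; set x := L2class mu f => Px.
apply/(L2on_proj (LS (ltW t0) Lf)); rewrite -(semigroup_classE SE (ltW t0) Lf).
apply: (semigroup_invariant hilE (semigroup_class_of aeE posE SE) proj_lin
  proj_sym proj_idem) => //; last exact: ltW.
  by move=> y Dy; apply: (dom_class aeE); exact: DA.
move=> y z Dy Dz; have Dr := DA _ Dy; have Drz := DA _ Dz.
have Dq := domB posE Dz Drz.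
rewrite -{1}(L2classK z) /proj -L2classB //; last exact: L2_restr.
by rewrite (form_re_class aeE posE Dr Dq) form_restr_orth.
Qed.

End restriction.

(** * The set-theoretic distance *)

(** Meant for the essential suprema [s1] of -psi on a set and [s2] of psi on another, whose gap is
    [- s1 - s2]; the value -oo arises for null sets. *)
Lemma ereal_gap (R : realType) (s1 s2 : \bar R) : (0 < - s1 - s2)%E ->
  exists r1 r2 : R, [/\ (s1 < r1%:E)%E, (s2 < r2%:E)%E & r1 + r2 < 0].
Proof.
case: s1 => [r1||]; case: s2 => [r2||] //=.
- rewrite lte_fin => r0; exists (r1 - (r1 + r2) / 3), (r2 - (r1 + r2) / 3).
  by rewrite !lte_fin; split; lra.
- by move=> _; exists (r1 + 1), (- r1 - 2); rewrite !lte_fin ltNyr; split => //; lra.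
- by move=> _; exists (- r2 - 2), (r2 + 1); rewrite !lte_fin ltNyr; split => //; lra.
- by move=> _; exists (-1), 0; rewrite !ltNyr; split => //; lra.
Qed.

(* Needed because instance resolution fails for [filterS] on [borel X], whose
   carrier is itself a topological space. *)
Section ae_imp.
Context {d : measure_display} {T : measurableType d} {R : realType}.
Variable mu : {measure set T -> \bar R}.
Implicit Types P Q : T -> Prop.

Lemma ae_imp P Q : (forall x, P x -> Q x) ->
  (\forall x \ae mu, P x) -> \forall x \ae mu, Q x.
Proof. exact: filterS. Qed.

Lemma ae_imp2 P P' Q : (forall x, P x -> P' x -> Q x) ->
  (\forall x \ae mu, P x) -> (\forall x \ae mu, P' x) -> \forall x \ae mu, Q x.
Proof. exact: filterS2. Qed.

Lemma ae_and P Q : (\forall x \ae mu, P x) -> (\forall x \ae mu, Q x) ->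
  \forall x \ae mu, P x /\ Q x.
Proof. exact: filterI. Qed.

End ae_imp.

Lemma normr_Re_le (R : realType) (z : R[i]) :
  `|complex.Re z| <= ComplexField.Normc.normc z.
Proof. by rewrite normc_sqrtE -sqrtr_sqr ler_wsqrtr // lerDl sqr_ge0. Qed.

Lemma normr_Im_le (R : realType) (z : R[i]) :
  `|complex.Im z| <= ComplexField.Normc.normc z.
Proof. by rewrite normc_sqrtE -sqrtr_sqr ler_wsqrtr // lerDr sqr_ge0. Qed.

Lemma ereal_unbounded (R : realType) (x : \bar R) :
  (forall n : nat, (n%:R%:E <= x)%E) -> x = +oo%E.
Proof.
case: x => [r H|//|/(_ 0%N)//].
have := H (Num.truncn r).+1; rewrite lee_fin leNgt => /negP[].
exact: truncnS_gt.
Qed.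

Lemma ess_sup_on_ae {d : measure_display} {T : measurableType d} {R : realType}
    (mu : {measure set T -> \bar R}) (B : set T) (u : T -> R) (m : R) :
  measurable B -> measurable_fun [set: T] u ->
  mu (B `&` [set x | m < u x]) = 0%E -> \forall x \ae mu, B x -> u x <= m.
Proof.
move=> mB mu_ B0; exists (B `&` [set x | m < u x]); split => //.
  apply: measurableI => //.
  rewrite (_ : [set x | m < u x] = [set: T] `&` u @^-1` `]m, +oo[%classic).
    by apply: mu_ => //; exact: measurable_itv.
  by apply/seteqP; split => x /=; rewrite in_itv /= andbT; [|case].
by move=> x /= /not_implyP[Bx /negP]; rewrite -ltNge.
Qed.

Lemma clip_eq0 (R : realFieldType) (t : R) : t <= 0 ->
  Num.min (Num.max t 0) 1 = 0.
Proof. by move=> t0; rewrite max_r // min_l. Qed.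

Lemma clip_eq1 (R : realFieldType) (t : R) : 1 <= t ->
  Num.min (Num.max t 0) 1 = 1.
Proof. by move=> t1; rewrite max_l ?min_r //; exact: le_trans t1. Qed.

(** * Distance and restriction of the form domain *)

Section distance.
Context {R : realType} {X : ptopologicalType}.
Variable mu : {measure set (borel X) -> \bar R}.
Variable E : L2form (borel X) R.
Hypothesis dirE : dirichlet_form mu E.
Hypothesis localE : local_form mu E.
Variable A : set (borel X).
Hypothesis mA : measurable A.

Let aeE := dirichlet_ae dirE.
Let posE := dirichlet_positive dirE.

Local Notation domR u := (dom E (cplx u)).

Lemma essupp_ae0 (u : borel X -> R) : compactly_supported mu u ->
  \forall x \ae mu, essupp mu u x \/ u x = 0.
Proof.
move=> [_ u0]; apply: ae_imp u0 => x ux.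
by have [xK|/ux] := pselect (essupp mu u x); [left | right].
Qed.

(** Almost everywhere [phi] vanishes or [g] equals n times the indicator. Locality applies three
    times: [g - n] annihilates [g \* phi], [g ^+ 2 - n ^+ 2] the part of [phi] in [A], and [g ^+ 2]
    the part off [A]. Stability of the domain under [restr A] places these pieces in it. *)
Lemma energy_indic_eq0 (n : R) (g phi : borel X -> R) :
  (forall f, dom E f -> dom E (restr A f)) ->
  domR g -> Linfty_real mu g -> domR phi -> compactly_supported mu phi ->
  (fun x => n * \1_A x) = g %[ae mu in essupp mu phi] ->
  energy E g phi = 0.
Proof.
move=> DA Dg [mg /Lnorm_oo_ltyP[M M0 gM]] Dphi /essupp_ae0 phi0 gE.
have phi_g : \forall x \ae mu, phi x = 0 \/ g x = n * \1_A x.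
  by apply: ae_imp2 phi0 gE => x [xK /(_ xK) <-|->]; [right|left].
have Dgg : domR (g \* g).
  have := domR_square dirE M0 Dg gM.
  by congr (dom E (cplx _)); apply/funext => x; rewrite expr2.
have Dr := DA _ Dphi.
have Dgp : domR (g \* phi).
  apply: (dom_ae aeE (dom_scale posE n%:C Dr)).
    have mgp := measurable_funM mg (domR_measurable dirE Dphi).
    exact: cmeasurable_cplx.
  apply: ae_imp phi_g => x [p0|gx] _ /=; rewrite restrE /cplx /=.
    by rewrite p0 !mulr0.
  by rewrite gx !rmorphM mulrA.
rewrite /energy (localE (a := - n) Dgp Dg); last first.
  apply: ae_imp phi_g => x [p0|gx] _; rewrite /cplx /=.
    by rewrite p0 !(mulr0, rmorph0).
  rewrite -rmorphD -rmorphM gx; case: (@indic01 _ (borel X) R A x) => ->.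
    by rewrite mulr0 mul0r mulr0.
  by rewrite mulr1 subrr mul0r.
have Dq := domB posE Dphi Dr.
have -> : cplx phi = restr A (cplx phi) \+ (cplx phi \- restr A (cplx phi)).
  by apply/funext => x /=; rewrite addrC subrK.
rewrite (form_hermitian posE (dom_add posE Dr Dq) Dgg) (form_add posE) //.
rewrite (localE (a := - n ^+ 2) Dr Dgg); last first.
  apply: ae_imp phi_g => x [p0|gx] _; rewrite restrE /cplx /=.
    by rewrite p0 rmorph0 !mulr0.
  rewrite -rmorphD -!rmorphM gx; case: (@indic01 _ (borel X) R A x) => ->.
    by rewrite mul0r mulr0.
  by rewrite mulr1 -expr2 subrr mul0r.
rewrite (localE (a := 0) Dq Dgg); last first.
  apply: ae_imp phi_g => x [p0|gx] _; rewrite /= restrE /cplx /=.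
    by rewrite p0 rmorph0 mulr0 subrr mulr0.
  rewrite addr0 gx; case: (@indic01 _ (borel X) R A x) => ->.
    by rewrite mulr0 mul0r rmorph0 mul0r.
  by rewrite mul1r subrr mulr0.
by rewrite addr0 conjc0 mulr0 subr0.
Qed.

Lemma invariant_distance : dom_loc mu E (cst 1) ->
  (forall f, dom E f -> dom E (restr A f)) ->
  set_distance mu E A (~` A) = +oo%E.
Proof.
move=> one_loc DA.
apply: ereal_unbounded => n; pose psi x : R := n%:R * \1_A x.
have psiA x : A x -> psi x = n%:R.
  by move=> xA; rewrite /psi indicE mem_set // mulr1.
have psiAc x : ~ A x -> psi x = 0.
  by move=> xA; rewrite /psi indicE memNset // mulr0.
have mpsi : measurable_fun [set: borel X] psi.
  apply: measurable_funM; [exact: measurable_cst | exact: measurable_indic].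
have psi_inf : Linfty_real mu psi.
  split => //; apply/Lnorm_oo_ltyP; exists (n%:R + 1); first by rewrite ltr_wpDl.
  apply: aeW => x; have [xA|xA] := pselect (A x).
    by rewrite psiA // ger0_norm // lerDl.
  by rewrite psiAc // normr0 addr_ge0.
have psi_dom : dom0 mu E psi.
  split => //.
    split; first exact: cmeasurable_cplx.
    move=> K /one_loc.2[e De eK]; exists (cst n%:R%:C \* restr A e).
      by apply: (dom_scale posE); exact: DA.
    apply: ae_imp eK => x ex xK; rewrite /= restrE -(ex xK) /= mulr1.
    by rewrite /cplx rmorphM.
  apply: ge_ereal_sup => _ [phi [Dphi [_ cphi] _] <-].
  suff -> : energy_hat mu E psi phi = 0 by rewrite ComplexField.Normc.normc0 lee_fin.
  rewrite /energy_hat; case: xgetP => [g _ [Dg Lg psig]|_].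
    exact: (energy_indic_eq0 (n := n%:R)).
  (* Without an extension [xget] returns its default [cst 0], whose energy vanishes as well. *)
  have D0 : domR (cst 0) by exact: dom_zero posE.
  have E0 phi' : domR phi' -> E (cplx (cst 0)) (cplx phi') = 0.
    move=> Dphi'; apply: (localE (a := 0) D0 Dphi').
    by apply: aeW => x _; rewrite /cplx /= mulr0.
  rewrite /energy (_ : cst 0 \* phi = cst 0); last first.
    by apply/funext => x /=; rewrite mul0r.
  rewrite (_ : cst 0 \* cst 0 = cst 0); last by apply/funext => x /=; rewrite mul0r.
  by rewrite !E0 // mulr0 subr0.
apply: le_trans (ereal_sup_ubound _); last by exists psi.
rewrite -[n%:R%:E]sube0; apply: leeB.
  rewrite leeNr; apply: ereal_inf_lbound; exists (- n%:R) => //=.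
  rewrite (_ : _ `&` _ = set0) ?measure0 //; apply/seteqP; split => // x [xA] /=.
  by rewrite psiA // ltxx.
apply: ereal_inf_lbound; exists 0 => //=.
rewrite (_ : _ `&` _ = set0) ?measure0 //; apply/seteqP; split => // x [xA] /=.
by rewrite psiAc // ltxx.
Qed.

(** Both [psi] and the constant one belong to the domain only locally, so a substitute for the
    indicator is built for each f of the core, on the support of f. Products require bounded
    factors; unbounded f are reached by approximation in the form norm, with energies controlled by
    [energy_restr_le]. *)
Lemma distance_invariant : dom_loc mu E (cst 1) ->
  core mu E (dom E `&` Linfty_c mu) ->
  (0 < set_distance mu E A (~` A))%E ->
  forall f, dom E f -> dom E (restr A f).
Proof.
move=> one_loc [_ _ coreE] /ereal_sup_gt[_ [psi [psi_loc [mpsi _] _] <-]].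
move=> /ereal_gap[r1 [r2 [lt1 lt2 r12]]].
have [_ [m1 m1P <-]] := ereal_inf_lt lt1; rewrite lte_fin => m1r1.
have [_ [m2 m2P <-]] := ereal_inf_lt lt2; rewrite lte_fin => m2r2.
pose a := - m1; pose b := m2.
have ba : b < a by rewrite /a /b; lra.
have psiA : \forall x \ae mu, A x -> a <= psi x.
  have mNpsi : measurable_fun [set: borel X] (fun x => - psi x).
    exact: measurableT_comp.
  apply: ae_imp (ess_sup_on_ae mA mNpsi m1P) => x psix /psix.
  by rewrite /a lerNl.
have psiAc : \forall x \ae mu, ~ A x -> psi x <= b.
  exact: ess_sup_on_ae (measurableC mA) mpsi m2P.
have core_case f : dom E f -> Linfty_c mu f -> dom E (restr A f).
  move=> Df [[mf /Lnorm_oo_ltyP[M M0 fM]] [Kcpt f0]].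
  have [g Dg psig] := psi_loc.2 _ Kcpt.
  have [e De onee] := one_loc.2 _ Kcpt.
  set K := essupp mu f in f0 psig onee.
  (* Almost everywhere on [K] this is [(psi - b) / (a - b)], with [e] in the role of the constant
     one: at least 1 on [A] and at most 0 off [A], so that truncation yields the indicator there. *)
  pose w x := (a - b)^-1 * (complex.Re (g x) + - b * complex.Re (e x)).
  have Dw : domR w.
    apply: (domR_scale dirE); apply: (domR_add dirE (dom_Re dirE Dg)).
    exact: (domR_scale dirE (- b) (dom_Re dirE De)).
  pose v x := Num.min (Num.max (w x) 0) 1.
  have [Dv _] := domR_clip dirE Dw.
  have v1 x : `|v x| <= 1.
    rewrite ger0_norm ?ge_min ?lexx ?orbT //.
    by rewrite le_min le_max lexx orbT ler01.
  have vf : \forall x \ae mu, f x = 0 \/ v x = \1_A x.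
    apply: ae_imp2 (ae_and (ae_and psiA psiAc) f0) (ae_and psig onee).
    move=> x [[xA xAc] fx] [xpsi xone].
    have [xK|/fx] := pselect (K x); last by left.
    right; rewrite /v /w -(xpsi xK) -(xone xK) /= mulr1 indicE.
    have ab0 : 0 < a - b by rewrite subr_gt0.
    have [Ax|Ax] := pselect (A x).
      rewrite mem_set // clip_eq1 // mulrC ler_pdivlMr // mul1r lerD2r.
      exact: xA.
    rewrite memNset // clip_eq0 // pmulr_rle0 ?invr_gt0 // subr_le0.
    exact: xAc.
  have M1 : 0 < M + 1 by rewrite addr_gt0.
  have part (u : borel X -> R) : domR u -> (forall x, `|u x| <= ComplexField.Normc.normc (f x)) ->
      domR (fun x => \1_A x * u x).
    move=> Du uf; apply: (@domR_ae _ _ _ mu E dirE (fun x => v x * u x)).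
    - apply: (domR_mul dirE M1 Dv Du).
        by apply: aeW => x; apply: le_trans (v1 x) _; rewrite lerDr ltW.
      apply: ae_imp fM => x /= xM; apply: le_trans (uf x) _.
      by apply: le_trans (ler_norm _) _; apply: le_trans xM _; rewrite lerDl.
    - have m1A : measurable_fun [set: borel X] (\1_A : borel X -> R).
        exact: measurable_indic.
      by have := measurable_funM m1A (domR_measurable dirE Du).
    - apply: ae_imp vf => x [fx|->] _ //.
      have -> : u x = 0.
        apply/eqP; rewrite -normr_le0; apply: le_trans (uf x) _.
        by rewrite fx ComplexField.Normc.normc0.
      by rewrite !mulr0.
  apply: (dom_parts dirE).
    suff : domR (fun x => \1_A x * complex.Re (f x)).
      by congr (dom E (cplx _)); apply/funext => x; rewrite Re_restr.
    by apply: part => [|x]; [exact: (dom_Re dirE) | exact: normr_Re_le].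
  suff : domR (fun x => \1_A x * complex.Im (f x)).
    by congr (dom E (cplx _)); apply/funext => x; rewrite Im_restr.
  by apply: part => [|x]; [exact: (dom_Im dirE) | exact: normr_Im_le].
move=> f Df; have Lf := dom_L2 aeE Df.
(* The constant bounds the energy of every g at form distance less than 1 from [f], since
   [g = f - (f - g)]; restriction to [A] does not increase it. *)
apply: (dom_lsc dirE (C := 2 * (complex.Re (E f f) + 1)) (L2_restr mA Lf)) => e e0.
have s0 : 0 < Num.min 1 (Num.sqrt e) by rewrite lt_min ltr01 sqrtr_gt0.
have [g [Dg gc] fg] := coreE f Df _ s0.
have Dr := core_case g Dg gc.
have Lg := dom_L2 aeE Dg.
have Dfg := domB posE Df Dg; have Lfg := dom_L2 aeE Dfg.
have Efg0 := energy_ge0 dirE Dfg; have ip0 := re_ip_ge0 mu (f \- g).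
have [E1 ipe] : complex.Re (E (f \- g) (f \- g)) <= 1 /\
    re_ip mu (f \- g) (f \- g) <= e.
  move: fg; rewrite form_normE // /graph_form (form_re_class aeE posE) //.
  rewrite L2ip_class // lt_min -{1}sqrtr1 !ltr_sqrt //.
  by move=> /andP[H1 H2]; split; lra.
exists (restr A g) => //; split.
  apply: le_trans (energy_restr_le dirE localE Dg Dr) _.
  have := psd_suble (form_re_psd aeE posE) (dom_class aeE Df) (dom_class aeE Dfg).
  have -> : L2class mu f - L2class mu (f \- g) = L2class mu g.
    by rewrite L2classB // opprB subrKC.
  rewrite !(form_re_class aeE posE) //.
  by move=> H; apply: le_trans H _; rewrite ler_pM2l // lerD2l.
have Lrgf : L2 mu (restr A g \- restr A f) by apply: L2B; exact: L2_restr.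
suff le_fg x : re_dot (restr A g \- restr A f) (restr A g \- restr A f) x
    <= 1 * re_dot (f \- g) (f \- g) x.
  by have [_] := L2_dominated Lfg Lrgf.1 le_fg; rewrite mul1r => /le_trans; apply.
have -> : re_dot (restr A g \- restr A f) (restr A g \- restr A f) x =
    \1_A x ^+ 2 * re_dot (f \- g) (f \- g) x.
  rewrite /re_dot /= !restrE -mulrBr !Re_mul !Im_mul /= -(opprB (f x)).
  by case: (f x - g x) => p r /=; ring.
by case: (@indic01 _ (borel X) R A x) => ->; rewrite ?expr1n ?mul1r // expr0n mul0r re_dot_ge0.
Qed.

End distance.

Local Close Scope complex_scope.

Theorem theorem1p3 (R : realType) (X : ptopologicalType)
  (hausdorff_X : hausdorff_space X)
  (mu : {sigma_finite_measure set (borel X) -> \bar R})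
  (E : L2form (borel X) R)
  (dirichlet_E : dirichlet_form mu E)
  (local_E : local_form mu E)
  (one_loc : dom_loc mu E (cst 1))
  (core_E : core mu E (dom E `&` Linfty_c mu))
  (S : R -> (borel X -> R[i]) -> (borel X -> R[i]))
  (S_generated : semigroup_generated_by mu (associated_operator mu E) S)
  (A : set X)
  (measurable_A : measurable (A : set (borel X))) :
  [<-> exists2 t : R, 0 < t & forall f : borel X -> R[i],
           L2on mu A f -> L2on mu A (S t f);
       forall t : R, 0 < t -> forall f : borel X -> R[i],
           L2on mu A f -> L2on mu A (S t f);
       set_distance mu E A (~` A) = +oo%E;
       (0 < set_distance mu E A (~` A))%E].
Proof.
have dom_dist := invariant_distance dirichlet_E local_E measurable_A one_loc.
have dist_dom := distance_invariant dirichlet_E local_E measurable_A one_loc core_E.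
have sg_dom t := invariant_dom measurable_A dirichlet_E S_generated (t := t).
have dom_sg := dom_invariant measurable_A dirichlet_E local_E S_generated.
tfae.
- by move=> [t t0 /(sg_dom t t0)/dom_sg].
- by move=> /(_ _ ltr01)/(sg_dom _ ltr01)/dom_dist.
- by move=> ->; exact: ltry.
- by move=> /dist_dom/dom_sg inv; exists 1 => //; exact: inv.
Qed.
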